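(* Let $0<\varepsilon<1$ and consider edge-weighted graphs with positive weights normalized so that the maximum edge weight is $1$. There is a deterministic $\mathrm{DistLocal}[r]$-algorithm for computing a $(1-\varepsilon)$-approximate maximum weighted matching (a matching $M$ with $w(M)\ge(1-\varepsilon)w(M^*_w)$, $M^*_w$ a maximum weight matching) with $$r\le O\!\left(\frac{1}{\varepsilon^2}\log\frac{1}{\varepsilon}\cdot\log^* n\right)+\Delta^{O(1/\varepsilon)}\cdot\log\left(\frac{1}{w_{\min}(\varepsilon)}\right).$$
   Context: $w_{\min}(\varepsilon)=\min\{w(e): w(e)\ge\varepsilon/n\}$, so $1/w_{\min}(\varepsilon)\le n/\varepsilon$; $w(F)=\sum_{e\in F}w(e)$. In the DistLocal model, computation takes place on an undirected graph with $n$ vertices and maximum degree $\Delta$; each vertex is a processor whose local input includes its distinct ID (polynomially bounded in $n$), its degree, $\Delta$, $n$, $\varepsilon$, the weights of its incident edges, and its ports. In synchronous rounds each vertex receives messages from neighbors, computes arbitrarily, and sends an unbounded-length message to each neighbor; after the last round each vertex outputs which incident edges are in the matching. $\mathrm{DistLocal}[r]$ means $r$ rounds.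
   Formalization: Both logarithms in the bound, log(1/ε) and log(1/w_min(ε)), are read as max(1, log₂ ·); literally, unit weights give log(1/w_min)=0 and a bound independent of Δ, contradicting the known lower bound for approximate matching. *)

(* Defs.v *)
From HB Require Import structures.
From mathcomp Require Import all_boot all_order all_algebra.
From mathcomp Require Import reals exp.

Set Implicit Arguments.
Unset Strict Implicit.
Unset Printing Implicit Defensive.

Import Order.TTheory GRing.Theory Num.Theory.
Local Open Scope ring_scope.

Section Logarithms.
Variable R : realType.

Definition log2 (x : R) : R := ln x / ln 2%:R.

(* log* n is the least i such that the i-th iterate of log2 at n is at most 1.
   Since log* n <= n, searching among 0, ..., n finds it. *)
Definition logstar (n : nat) : nat :=
  find (fun i => iter i log2 n%:R <= 1) (iota 0 n.+1).

(* The logarithm of asymptotic bounds: it equals log2 x for x >= 2 and is kept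
   at least 1 below. A bare logarithm would vanish on unit weights and leave a
   bound independent of the maximum degree, which contradicts the lower bounds
   known for approximate matching. *)
Definition lg (x : R) : R := Num.max 1 (log2 x).

End Logarithms.

Section WeightedGraphs.
Variable R : realType.

Record wgraph := WGraph {
  vert :> finType;
  edges : {set {set vert}};
  edges_card2 : forall e, e \in edges -> #|e| = 2%N;
  wt : {set vert} -> R;
  wt_gt0 : forall e, e \in edges -> 0 < wt e
}.

Variable G : wgraph.

Definition nbrs (v : G) : {set G} := [set u | [set v; u] \in edges G].

Definition max_degree : nat := \max_(v : G) #|nbrs v|.

Definition weight (F : {set {set G}}) : R := \sum_(e in F) wt e.

Definition normalized : Prop := \big[Num.max/0]_(e in edges G) wt e = 1.

Definition matching (M : {set {set G}}) : bool :=
  (M \subset edges G) && trivIset M.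

Definition max_weight_matching (M : {set {set G}}) : Prop :=
  matching M /\ forall M', matching M' -> weight M' <= weight M.

Definition approx_mwm (eps : R) (M : {set {set G}}) : Prop :=
  matching M /\
  forall Mopt, max_weight_matching Mopt -> (1 - eps) * weight Mopt <= weight M.

(* On a normalized graph the default value 1 does not alter the minimum: all
   weights are at most 1, and an edge of weight 1 belongs to the range. *)
Definition wmin (eps : R) : R :=
  \big[Num.min/1]_(e in edges G | eps / #|G|%:R <= wt e) wt e.

End WeightedGraphs.

Section DistLocal.
Variable R : realType.

(* [ports v] lists the neighbours of v in an arbitrary order; port i of v is
   position i of that list. *)
Record network (G : wgraph R) := Network {
  ident : G -> nat;
  ident_inj : injective ident;
  ports : G -> seq G;
  ports_uniq : forall v, uniq (ports v);
  ports_nbrs : forall v, ports v =i nbrs v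
}.

(* [in_wts] lists the weights of the incident edges in the order of the ports,
   which are numbered from 0 to [in_deg] - 1. *)
Record local_input := LocalInput {
  in_id : nat;
  in_deg : nat;
  in_maxdeg : nat;
  in_n : nat;
  in_eps : R;
  in_wts : seq R
}.

(* [alg_send s i] is the message sent through port i in state s, and
   [alg_recv s ms] the state reached from s when ms lists the messages received
   through the ports, in order. [alg_out s] is [None] as long as the vertex has
   not fixed its output; the output is the set of the ports whose edges are in
   the matching. *)
Record algorithm := Algorithm {
  alg_state : Type;
  alg_msg : Type;
  alg_init : local_input -> alg_state;
  alg_send : alg_state -> nat -> alg_msg;
  alg_recv : alg_state -> seq alg_msg -> alg_state;
  alg_out : alg_state -> option (pred nat)
}.

Variables (A : algorithm) (G : wgraph R) (N : network G) (eps : R).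

Definition input_at (v : G) : local_input :=
  {| in_id := ident N v;
     in_deg := #|nbrs v|;
     in_maxdeg := max_degree G;
     in_n := #|G|;
     in_eps := eps;
     in_wts := [seq wt [set v; u] | u <- ports N v] |}.

Fixpoint state_at (t : nat) (v : G) : alg_state A :=
  if t is t'.+1 then
    alg_recv (state_at t' v)
      [seq alg_send (state_at t' u) (index v (ports N u)) | u <- ports N v]
  else alg_init A (input_at v).

(* An output is irrevocable: only the first one produced counts. *)
Fixpoint output_at (t : nat) (v : G) : option (pred nat) :=
  if t is t'.+1 then
    if output_at t' v is Some o then Some o else alg_out (state_at t v)
  else alg_out (state_at 0 v).

(* After r rounds every vertex has produced its output, and the two endpoints
   of every edge agree on whether that edge is in M. *)
Definition computes_in (r : nat) (M : {set {set G}}) : Prop :=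
  forall v : G, exists2 o : pred nat,
    output_at r v = Some o &
    forall u, u \in nbrs v -> o (index u (ports N v)) = ([set v; u] \in M).

End DistLocal.

(* Main.v *)
Require Import Defs.
From HB Require Import structures.
From mathcomp Require Import all_boot all_order all_algebra finfield.
From mathcomp Require Import zify ring lra.
From mathcomp Require Import boolp reals exp.

(* Edges lighter than eps/n are dropped, which costs at most eps/2. The matching
   is improved by local search: colour the vertices so that equal colours are at
   distance Omega(1/eps) (Linial's colour reduction, log* n steps), then sweep over
   thresholds T0/2^j and colours, letting each vertex of the current colour replace
   the matching inside its ball of radius O(1/eps) when this gains at least the
   threshold. If O is optimal, walking along the permutation mu o mu' (the
   partner functions of M and O) shows that the best local gains sum to at least
   w(O) - (1 + 1/k) w(M); as thresholds decrease, a local gain destroyed during a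
   sweep is paid for by the change that destroyed it, so one sweep realizes a
   fraction Delta^(-O(1/eps)) of this sum, and Delta^O(1/eps) sweeps suffice.

   No vertex knows w_min. But a vertex ignores the thresholds far below the edge
   weights in its ball, so only O(log(1/w_min)) + Delta^O(1/eps) thresholds per sweep
   have any effect, and the result at a vertex is determined by a ball of the
   announced radius. Each vertex collects its view and outputs as soon as all
   networks with that view yield the same result. *)

Set Implicit Arguments.
Unset Strict Implicit.
Unset Printing Implicit Defensive.

Import Order.TTheory GRing.Theory Num.Theory.
Local Open Scope ring_scope.

(** * Balls and local changes *)

Section Balls.
Variables (R : realType) (I : finType).
Implicit Types (W : I -> I -> R) (i j u v : I) (s t : nat).

(** A graph is given by a weight matrix, a zero entry meaning that there is no edge. Different
    graphs thus live on the same index type and can be compared. *)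
Definition nb W i : {set I} := [set j | 0 < W i j].

Fixpoint ball W t i : {set I} :=
  if t is t'.+1 then i |: \bigcup_(j in nb W i) ball W t' j else [set i].

Lemma ball_refl W t i : i \in ball W t i.
Proof. by case: t => [|t]; rewrite /= !inE eqxx. Qed.

Lemma ballSP W t i j :
  reflect (j = i \/ exists2 l, 0 < W i l & j \in ball W t l)
          (j \in ball W t.+1 i).
Proof.
rewrite /= in_setU1; apply: (iffP orP) => [[/eqP|/bigcupP[l]]|[->|[l il jl]]].
- by left.
- by rewrite inE => il jl; right; exists l.
- by left.
- by right; apply/bigcupP; exists l; rewrite ?inE.
Qed.

Lemma ball_leS W t i j : j \in ball W t i -> j \in ball W t.+1 i.
Proof.
elim: t i => [|t IH] i; first by rewrite inE => /eqP->; apply: ball_refl.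
case/ballSP=> [->|[l il jl]]; first exact: ball_refl.
by apply/ballSP; right; exists l => //; apply: IH.
Qed.

Lemma ball_le W s t i j : (s <= t)%N -> j \in ball W s i -> j \in ball W t i.
Proof.
move=> /subnK<-; elim: (t - s)%N => // m IH /IH.
by rewrite addSn; apply: ball_leS.
Qed.

Lemma ball_cat W s t i j l :
  j \in ball W s i -> l \in ball W t j -> l \in ball W (s + t) i.
Proof.
elim: s i => [|s IH] i; first by rewrite /= inE => /eqP->.
case/ballSP => [->|[m im jm]] lj; first by apply: ball_le lj; lia.
by rewrite addSn; apply/ballSP; right; exists m => //; apply: IH.
Qed.

Lemma ball_edge W i j : 0 < W i j -> j \in ball W 1 i.
Proof. by move=> ij; apply/ballSP; right; exists j => //; rewrite inE. Qed.

Definition wsym W := forall i j, W i j = W j i.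

Lemma ball_sym W t i j : wsym W -> j \in ball W t i -> i \in ball W t j.
Proof.
move=> sW; elim: t i => [|t IH] i; first by rewrite !inE eq_sym.
case/ballSP=> [->|[l il /IH jl]]; first exact: ball_refl.
by rewrite -addn1; apply: ball_cat jl _; apply: ball_edge; rewrite sW.
Qed.

Lemma ball_symE W t i j : wsym W -> (j \in ball W t i) = (i \in ball W t j).
Proof. by move=> sW; apply/idP/idP; apply: ball_sym. Qed.

Lemma card_ball W b t i :
  (forall j, (#|nb W j| < b)%N) -> (#|ball W t i| <= b ^ t)%N.
Proof.
move=> dW; elim: t i => [|t IH] i; first by rewrite cards1.
rewrite /= (leq_trans (leq_card_setU _ _)) // cards1 expnS.
have: (#|\bigcup_(j in nb W i) ball W t j| <= #|nb W i| * b ^ t)%N.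
  rewrite -sum_nat_const; elim/big_rec2: _ => [|j A m _ h]; first by rewrite cards0.
  by rewrite (leq_trans (leq_card_setU _ _)) // leq_add.
have := dW i; have : (0 < b ^ t)%N by rewrite expn_gt0 (leq_ltn_trans _ (dW i)).
nia.
Qed.

(** Whole rows are compared, so edges leaving the ball are included. *)
Definition agree W W' t i := forall x, x \in ball W t i -> W x =1 W' x.

Lemma agree_sub W W' s t i j :
  j \in ball W s i -> agree W W' (s + t) i -> agree W W' t j.
Proof. by move=> ji ag x xj; apply: ag; apply: ball_cat ji xj. Qed.

Lemma agree_le W W' s t i : (s <= t)%N -> agree W W' t i -> agree W W' s i.
Proof. by move=> st ag x xi; apply: ag; apply: ball_le xi. Qed.

Lemma agree_ball W W' t i : agree W W' t i -> ball W t i = ball W' t i.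
Proof.
elim: t i => [//|t IH] i ag.
have nbE : nb W i = nb W' i.
  by apply/setP=> j; rewrite !inE (ag i) // ball_refl.
congr (_ |: _); rewrite -nbE; apply: eq_bigr => j; rewrite inE => ij.
by apply: IH; apply: agree_sub (ball_edge ij) _.
Qed.

End Balls.

(** * Local changes of a matching, and parallel steps of one colour class *)

Section LocalChanges.
Variables (R : realType) (I : finType).
Implicit Types (W : I -> I -> R) (mu : I -> I) (u v : I).

(** A matching is the involution that exchanges partners; its fixed points are the unmatched
    vertices. *)
Definition mtch W mu := involutive mu /\ forall v, mu v = v \/ 0 < W v (mu v).

(* The weight of a matching, counted once from each endpoint. *)
Definition wt2 W mu : R := \sum_v W v (mu v).

(* A vertex of the ball whose partner lies outside keeps its partner, so that a
   change can be validated inside the ball. *)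
Definition chg W (rho : nat) u mu (nu : I -> I) : bool :=
  [forall v in ball W rho u,
     if mu v \in ball W rho u then
       [&& nu v \in ball W rho u, nu (nu v) == v & (nu v == v) || (0 < W v (nu v))]
     else nu v == mu v].

(** For a [nu] with [chg], edges across the boundary of the ball cancel here, so this is the full
    change of [wt2] caused by the replacement. *)
Definition gain W (rho : nat) u mu (nu : I -> I) : R :=
  \sum_(v in ball W rho u) (W v (nu v) - W v (mu v)).

Definition improve W rho (tau : R) u mu : option {ffun I -> I} :=
  [pick nu : {ffun I -> I} | chg W rho u mu nu && (tau <= gain W rho u mu nu)].

(* Makes the steps with s below all weights of the ball idle, whatever happens
   elsewhere in the graph. *)
Definition active W rho (s : R) u : bool :=
  [exists x in ball W rho u, [exists y, (0 < W x y) && (W x y <= s)]].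

(** Described from the side of the affected vertex [v], which looks for the centre responsible for
    it; a colouring proper at distance [rho.*2] leaves at most one candidate. *)
Definition step W rho (col : I -> nat) (tau s : R) (c : nat) mu v : I :=
  if [pick u | [&& u \in ball W rho v, col u == c & active W rho s u]] is Some u
  then if improve W rho tau u mu is Some nu then nu v else mu v
  else mu v.

Definition proper_col W (t : nat) (col : I -> nat) :=
  forall u v, v \in ball W t u -> col u = col v -> u = v.

Definition movers W rho (col : I -> nat) tau s c mu : {set I} :=
  [set u | [&& col u == c, active W rho s u & improve W rho tau u mu != None]].

Lemma improveP W rho tau u mu nu : improve W rho tau u mu = Some nu ->
  chg W rho u mu nu /\ tau <= gain W rho u mu nu.
Proof. by rewrite /improve; case: pickP => // x /andP[h1 h2] [<-]. Qed.

Section Step.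
Variables (W : I -> I -> R) (rho : nat) (col : I -> nat) (tau s : R) (c : nat).
Variable mu : I -> I.
Hypotheses (sW : wsym W) (pcol : proper_col W rho.*2 col) (mmu : mtch W mu).

Let B := ball W rho.
Let stp := step W rho col tau s c mu.
Let A := movers W rho col tau s c mu.

Lemma centre_uniq u u' v : col u = col u' -> v \in B u -> v \in B u' -> u = u'.
Proof.
move=> cuu vu vu'; apply: pcol => //; rewrite -addnn.
by apply: ball_cat vu _; rewrite ball_symE.
Qed.

Lemma step_mover u nu v : u \in A -> v \in B u ->
  improve W rho tau u mu = Some nu -> stp v = nu v.
Proof.
rewrite inE => /and3P[/eqP cu au _] vu iu; rewrite /stp /step.
case: pickP => [u' /and3P[u'v /eqP cu' _]|/(_ u)]; last first.
  by rewrite ball_symE // vu cu eqxx au.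
have <- : u = u' by apply: (@centre_uniq _ _ v); rewrite ?cu // /B ball_symE.
by rewrite iu.
Qed.

Lemma step_still v : (forall u, u \in A -> v \notin B u) -> stp v = mu v.
Proof.
move=> h; rewrite /stp /step; case: pickP => // u /and3P[uv cu au].
case iu: improve => [nu|//]; have := h u; rewrite inE cu au iu /=.
by rewrite /B ball_symE // uv => /(_ isT).
Qed.

Lemma step_changed v : stp v != mu v -> exists2 u, u \in A & v \in B u.
Proof.
move=> ne; case: (pickP [pred u | (u \in A) && (v \in B u)]) => [u /andP[]|h].
  by exists u.
case/eqP: ne; apply: step_still => u uA; apply/negP=> vu.
by have := h u; rewrite /= uA vu.
Qed.

Lemma mover_improve u : u \in A -> exists nu, improve W rho tau u mu = Some nu.
Proof. by rewrite inE; case: improve => [nu|]; rewrite ?andbF //; exists nu. Qed.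

(** The balls of distinct movers are disjoint. Within a ball [chg] provides an involution; an edge
    across a boundary is kept at both ends, since neither end may drop it. *)
Lemma step_mtch : mtch W stp.
Proof.
have [invm em] := mmu.
have bdry u nu v : chg W rho u mu nu -> v \in B u -> mu v \notin B u -> nu v = mu v.
  by move=> /forall_inP/(_ v) h vu nv; move: (h vu); rewrite (negPf nv) => /eqP.
have inn u nu v : chg W rho u mu nu -> v \in B u -> mu v \in B u ->
    [/\ nu v \in B u, nu (nu v) = v & nu v = v \/ 0 < W v (nu v)].
  move=> /forall_inP/(_ v) h vu nv; move: (h vu); rewrite nv.
  by case/and3P => -> /eqP -> /orP[/eqP|]; split; auto.
split=> v.
- case: (pickP [pred u | (u \in A) && (v \in B u)]) => [u /andP[uA vu]|h].
    have [nu iu] := mover_improve uA; have [cu _] := improveP iu.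
    rewrite (step_mover uA vu iu).
    case: (boolP (mu v \in B u)) => mvu.
      by have [nvu nnv _] := inn _ _ _ cu vu mvu; rewrite (step_mover uA nvu iu).
    rewrite (bdry _ _ _ cu vu mvu).
    case: (pickP [pred u | (u \in A) && (mu v \in B u)]) => [u' /andP[u'A vu']|h].
      have [nu' iu'] := mover_improve u'A; have [cu' _] := improveP iu'.
      rewrite (step_mover u'A vu' iu') (bdry _ _ _ cu') // ?invm //.
      apply/negP=> vu''; have uu' : u = u'.
        apply: (@centre_uniq _ _ v) => //; move: uA u'A; rewrite !inE.
        by case/and3P=> /eqP-> _ _ /and3P[/eqP-> _ _].
      by rewrite uu' vu' in mvu.
    by rewrite step_still ?invm // => u' u'A; have := h u'; rewrite /= u'A => /negbT.
  have sv : stp v = mu v.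
    by apply: step_still => u uA; have := h u; rewrite /= uA => /negbT.
  rewrite sv.
  case: (pickP [pred u | (u \in A) && (mu v \in B u)]) => [u' /andP[u'A vu']|h'].
    have [nu' iu'] := mover_improve u'A; have [cu' _] := improveP iu'.
    rewrite (step_mover u'A vu' iu') (bdry _ _ _ cu') // ?invm //.
    by apply/negP=> vu; have := h u'; rewrite /= u'A vu.
  by rewrite step_still ?invm // => u' u'A; have := h' u'; rewrite /= u'A => /negbT.
- case: (pickP [pred u | (u \in A) && (v \in B u)]) => [u /andP[uA vu]|h].
    have [nu iu] := mover_improve uA; have [cu _] := improveP iu.
    rewrite (step_mover uA vu iu).
    case: (boolP (mu v \in B u)) => mvu; first by have [] := inn _ _ _ cu vu mvu.
    by rewrite (bdry _ _ _ cu vu mvu).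
  by rewrite step_still // => u uA; have := h u; rewrite /= uA => /negbT.
Qed.

(** By disjointness the weight grows by exactly the sum of the gains of the movers, each of which is
    at least [tau]. *)
Lemma step_gain : wt2 W mu + tau * #|A|%:R <= wt2 W stp.
Proof.
rewrite -lerBrDl /wt2 -sumrB.
pose f v := W v (stp v) - W v (mu v).
have -> : \sum_v (W v (stp v) - W v (mu v)) = \sum_(u in A) \sum_(v in B u) f v.
  rewrite (exchange_big_dep xpredT) //=; apply: eq_bigr => v _.
  case: (pickP [pred u | (u \in A) && (v \in B u)]) => [u /= uAv|h].
    rewrite (big_pred1 u) // => u'; apply/idP/eqP => [|->//].
    case/andP=> u'A vu'; case/andP: uAv => uA vu; apply: centre_uniq vu' vu.
    by move: uA u'A; rewrite !inE => /and3P[/eqP-> _ _] /and3P[/eqP->].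
  rewrite big_pred0 // step_still ?subrr // => u uA.
  by have := h u; rewrite /= uA => /negbT.
rewrite mulr_natr -sumr_const; apply: ler_sum => u uA.
have [nu iu] := mover_improve uA; have [cu gu] := improveP iu.
apply: le_trans gu _; rewrite le_eqVlt; apply/orP; left; apply/eqP.
by apply: eq_bigr => v vu; rewrite /f (step_mover uA vu iu).
Qed.

End Step.

End LocalChanges.

(** * Alternating walks *)

Lemma sum_ltn_nat (N m : nat) : (\sum_(t < N) (t < m) = minn N m)%N.
Proof.
elim: N => [|N IH]; first by rewrite big_ord0 min0n.
by rewrite big_ord_recr /= IH; case: ltnP; lia.
Qed.

Section Walks.
Variables (R : realType) (I : finType) (W : I -> I -> R) (k : nat).
Variables mu ms : I -> I.
Hypotheses (W0 : forall v, W v v = 0) (Wge0 : forall u v, 0 <= W u v).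
Hypotheses (mmu : mtch W mu) (mms : mtch W ms).
Implicit Types u v : I.

(** A walk from [u] alternates edges of [ms] and [mu]. Below, [mul u v] counts, from both ends, its
    visits to the [ms]-edge at [v]. *)
Let pi u := mu (ms u).

Let cnt n u v : nat := \sum_(i < n) (iter i pi u == v).
Let mul u v : nat := cnt k u v + cnt k u (ms v).
(** A walk may repeat edges; it is cut into layers by multiplicity. Layer [t] inserts the [ms]-edges
    of multiplicity above [t], leaves single those vertices whose [mu]-partner they take, and keeps
    the rest. *)
Let nu u t v := if (t < mul u v)%N then ms v
                else if (t < mul u (mu v))%N then v else mu v.

Lemma mtch_ball x f : mtch W f -> f x \in ball W 1 x.
Proof. by case=> _ /(_ x)[->|]; [apply: ball_refl|apply: ball_edge]. Qed.

Lemma iter_pi_ball i u : iter i pi u \in ball W i.*2 u.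
Proof.
elim: i => [|i IH]; first exact: ball_refl.
rewrite iterS doubleS -addn2; apply: ball_cat IH _.
by apply: (@ball_cat _ _ _ 1 1 _ (ms (iter i pi u))); apply: mtch_ball.
Qed.

Lemma cnt_gt0 n u v : (0 < cnt n u v)%N -> exists2 i, (i < n)%N & iter i pi u = v.
Proof.
rewrite /cnt lt0n sum_nat_eq0 negb_forall => /existsP[i].
by rewrite /= eqb0 negbK => /eqP <-; exists i.
Qed.

(** The radius is one below that of the ball, which leaves room for the [mu]-partners of the
    inserted edges. *)
Lemma mul_ball u v : (0 < mul u v)%N -> v \in ball W k.*2.-1 u.
Proof.
rewrite /mul addn_gt0 => /orP[] /cnt_gt0[i ik iv].
  by apply: (@ball_le _ _ _ i.*2); [lia|rewrite -iv iter_pi_ball].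
have -> : v = ms (iter i pi u) by rewrite iv (proj1 mms).
apply: (@ball_le _ _ _ (i.*2 + 1)); first by lia.
by apply: ball_cat (iter_pi_ball i u) _; apply: mtch_ball.
Qed.

Lemma mul_ball' u v : (0 < mul u (mu v))%N -> v \in ball W k.*2 u.
Proof.
move=> h; have k0 : (0 < k)%N.
  by case: (posnP k) h => // k0; rewrite /mul /cnt k0 !big_ord0.
have := mul_ball h; set w := mu v => wu.
have -> : v = mu w by rewrite /w (proj1 mmu).
have -> : k.*2 = (k.*2.-1 + 1)%N by lia.
by apply: ball_cat wu _; apply: mtch_ball.
Qed.

Lemma mulms u v : mul u (ms v) = mul u v.
Proof. by rewrite /mul (proj1 mms) addnC. Qed.

Lemma mul_le u v : (mul u v <= k.*2)%N.
Proof.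
have h w : (cnt k u w <= k)%N.
  by rewrite -[leqRHS]muln1 -[in leqRHS](card_ord k) -sum_nat_const leq_sum // => i _; case: eqP.
by rewrite -addnn leq_add.
Qed.

Lemma nu_chg u t : chg W k.*2 u mu (nu u t).
Proof.
have [imu emu] := mmu; have [ims ems] := mms.
apply/forall_inP => v vu; rewrite /nu; case: (ltnP t) => hv.
  have v1 : v \in ball W k.*2.-1 u by apply: mul_ball; lia.
  have m1 : ms v \in ball W k.*2.-1 u by apply: mul_ball; rewrite mulms; lia.
  have -> : mu v \in ball W k.*2 u by apply: mul_ball'; rewrite imu; lia.
  rewrite mulms hv ims eqxx (ball_le _ m1) ?leq_pred //=.
  by case: (ems v) => [->|->]; rewrite ?eqxx ?orbT.
case: (ltnP t) => hm.
  rewrite (ltnNge t) hv /= hm vu !eqxx /=.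
  have -> // : mu v \in ball W k.*2 u.
  by apply: ball_le (@mul_ball _ _ _); [exact: leq_pred|lia].
case: ifP => // ->; rewrite ltnNge hm /= imu ltnNge hv /= eqxx /=.
by case: (emu v) => [->|->]; rewrite ?eqxx ?orbT.
Qed.

Lemma nu_gain u t : gain W k.*2 u mu (nu u t) =
  \sum_v ((t < mul u v)%N%:R * W v (ms v)
     - ((t < mul u v) || (t < mul u (mu v)))%N%:R * W v (mu v)).
Proof.
rewrite /gain big_mkcond; apply: eq_bigr => v _; rewrite /nu.
case: (ltnP t (mul u v)) => hv /=.
  rewrite (ball_le (leq_pred _) (@mul_ball u v _)) ?mul1r ?mul1r //; lia.
case: (ltnP t) => hm; last by rewrite subrr if_same !mul0r subrr.
rewrite mul_ball' ?W0 ?mul0r ?mul1r //; lia.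
Qed.

(** A visit to [ms v] is followed one step later by a visit to [mu v]. This shift is the source of
    [k.+1], hence of the factor [1 + 1/k]. *)
Lemma cnt_ms u v : (cnt k u (ms v) <= cnt k.+1 u (mu v))%N.
Proof.
rewrite /cnt big_ord_recl /=.
apply: leq_trans (leq_addl _ _); apply: leq_sum => i _.
case: (altP (iter i pi u =P ms v)) => // iv.
by rewrite iv /pi (proj1 mms) eqxx.
Qed.

Lemma cntS u v : (cnt k u v <= cnt k.+1 u v)%N.
Proof. by rewrite /cnt big_ord_recr leq_addr. Qed.

(** The [mu]-edge at [v] is lost in as many layers as the larger multiplicity of its two ends. Both
    are at most the number of visits to these ends in [k.+1] steps. *)
Lemma layer_sum u : \sum_(t < k.*2) gain W k.*2 u mu (nu u t) >=
  \sum_v ((mul u v)%:R * W v (ms v)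
     - (cnt k.+1 u v + cnt k.+1 u (mu v))%:R * W v (mu v)).
Proof.
under [leRHS]eq_bigr do rewrite nu_gain.
rewrite exchange_big /=; apply: ler_sum => v _.
rewrite sumrB -!mulr_suml -!natr_sum sum_ltn_nat.
rewrite (minn_idPr (mul_le u v)) lerD2l lerN2 ler_wpM2r // ler_nat.
set N := (_ + _)%N; apply: (@leq_trans (\sum_(t < k.*2) (t < N))%N).
  apply: leq_sum => t _.
  have h1 : (mul u v <= N)%N by apply: leq_add (cntS _ _) (cnt_ms _ _).
  have h2 : (mul u (mu v) <= N)%N.
    rewrite /N addnC; apply: leq_add (cntS _ _) _.
    by have := cnt_ms u (mu v); rewrite (proj1 mmu).
  case: (ltnP t N) => hN; first by case: (_ || _).
  by rewrite !ltnNge (leq_trans h1) // (leq_trans h2).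
by rewrite sum_ltn_nat geq_minr.
Qed.

Lemma pi_inj : injective pi.
Proof. by move=> x y /(inv_inj (proj1 mmu)) /(inv_inj (proj1 mms)). Qed.

(** Iterates of [pi] are permutations, so for each time exactly one start reaches [v]. *)
Lemma sum_cnt n v : (\sum_u cnt n u v = n)%N.
Proof.
rewrite /cnt exchange_big /= -[RHS]muln1 -[X in (X * 1)%N]card_ord -sum_nat_const.
apply: eq_bigr => i _.
have fi : injective (iter i pi).
  elim: (i : nat) => [//|j IH] x y /=; by move/pi_inj/IH.
rewrite -big_mkcond /= sum1_card.
have [g fg gf] := injF_bij fi.
rewrite -(card1 (g v)); apply: eq_card => u; rewrite !inE.
by apply/eqP/eqP => [<-|->]; rewrite ?fg ?gf.
Qed.

(* Summing over all starting points, every vertex lies on 2k of the walks of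
   length k; a walk reflects at the ends of the alternating paths because pi
   is a permutation, so no end effects arise. *)
Lemma local_gain_sum (h : I -> R) :
  (forall u nu, chg W k.*2 u mu nu -> gain W k.*2 u mu nu <= h u) ->
  k.*2%:R * wt2 W ms - (k.+1).*2%:R * wt2 W mu <= k.*2%:R * \sum_u h u.
Proof.
move=> hh.
have : \sum_u \sum_(t < k.*2) gain W k.*2 u mu (nu u t) <= k.*2%:R * \sum_u h u.
  rewrite mulr_sumr; apply: ler_sum => u _.
  rewrite -[X in _ <= X%:R * _]card_ord mulr_natl -sumr_const; apply: ler_sum => t _.
  by apply: hh; apply: nu_chg.
apply: le_trans; apply: le_trans (ler_sum _ (fun u _ => layer_sum u)).
rewrite exchange_big /= /wt2 !mulr_sumr -sumrB; apply: ler_sum => v _.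
rewrite sumrB -!mulr_suml -!natr_sum !big_split /= !sum_cnt.
by rewrite !addnn.
Qed.

End Walks.

(** * One sweep *)

Lemma max_mtch (R : realType) (I : finType) (W : I -> I -> R) :
  exists2 ms, mtch W ms & forall mu, mtch W mu -> wt2 W mu <= wt2 W ms.
Proof.
pose P (f : {ffun I -> I}) := `[< mtch W f >].
have Pid : P [ffun x => x].
  by apply/asboolP; split=> v; rewrite !ffunE //; left.
case: (@arg_maxP _ _ _ [ffun x => x] P (fun f => wt2 W f) Pid) => f /asboolP mf fmax.
exists f => // mu mmu; have -> : wt2 W mu = wt2 W [ffun x => mu x].
  by apply: eq_bigr => v _; rewrite ffunE.
apply: fmax; apply/asboolP; case: mmu => imu emu.
by split=> v; rewrite !ffunE.
Qed.

Section Rounds.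
Variables (R : realType) (I : finType) (W : I -> I -> R) (k b C J : nat).
Variables (col : I -> nat) (T0 theta : R).

Let rho := k.*2.

Definition thr (T0 : R) (i : nat) : R := T0 / 2 ^+ i.

(** All [C] colours are treated at one threshold before the threshold is halved. *)
Fixpoint run (i : nat) (mu : I -> I) : I -> I :=
  if i is i'.+1 then
    step W rho col (thr T0 (i' %/ C)) (thr T0 (i' %/ C) / theta) (i' %% C)
         (run i' mu)
  else mu.

Hypotheses (sW : wsym W) (W0 : forall v, W v v = 0) (Wge0 : forall u v, 0 <= W u v).
Hypotheses (Wle1 : forall u v, W u v <= 1) (degW : forall v, (#|nb W v| < b)%N).
Hypotheses (pcol : proper_col W rho.*2 col) (colC : forall v, (col v < C)%N).
Hypotheses (T0E : T0 = (b ^ rho)%:R) (theta0 : 0 < theta).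
Hypothesis low : forall u v, 0 < W u v -> thr T0 J <= theta * W u v.
Variable mu : I -> I.
Hypothesis mmu : mtch W mu.

Lemma T0_ge0 : 0 <= T0. Proof. by rewrite T0E ler0n. Qed.

Lemma thr_ge0 i : 0 <= thr T0 i.
Proof. by rewrite /thr divr_ge0 ?T0_ge0 ?exprn_ge0. Qed.

Lemma thr_le i j : (i <= j)%N -> thr T0 j <= thr T0 i.
Proof.
move=> ij; rewrite /thr ler_wpM2l ?T0_ge0 // lef_pV2 ?posrE ?exprn_gt0 //.
by rewrite ler_weXn2l // ler1n.
Qed.

Lemma thrS i : thr T0 i = 2 * thr T0 i.+1.
Proof. by rewrite /thr exprS invfM mulrCA mulVKf ?pnatr_eq0. Qed.

Let m i := run i mu.
Let A i := movers W rho col (thr T0 (i %/ C)) (thr T0 (i %/ C) / theta) (i %% C)%N (m i).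
(** The charge that [u] receives in step [i]: each mover whose ball may meet the ball of [u]
    contributes its threshold. *)
Let load i u : R := thr T0 (i %/ C) * #|[set u' in A i | u \in ball W rho.*2 u']|%:R.

Lemma run_mtch i : mtch W (m i).
Proof. by elim: i => //= i IH; apply: step_mtch. Qed.

Lemma run_gain i : wt2 W (m i) + thr T0 (i %/ C) * #|A i|%:R <= wt2 W (m i.+1).
Proof. exact: step_gain. Qed.

Lemma run_mono i : wt2 W mu <= wt2 W (m i).
Proof.
elim: i => // i IH; apply: le_trans IH (le_trans _ (run_gain i)).
by rewrite lerDl mulr_ge0 ?thr_ge0.
Qed.

Lemma load_ge0 i u : 0 <= load i u.
Proof. by rewrite mulr_ge0 ?thr_ge0. Qed.

(** A mover is charged to at most [b ^ rho.*2] vertices, and its threshold is covered by its own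
    gain. *)
Lemma sum_load n :
  \sum_u \sum_(i < n) load i u <= (b ^ rho.*2)%:R * (wt2 W (m n) - wt2 W mu).
Proof.
rewrite exchange_big /=; elim: n => [|n IH].
  by rewrite big_ord0 subrr mulr0.
rewrite big_ord_recr /=.
have h : \sum_u load n u <= (b ^ rho.*2)%:R * (wt2 W (m n.+1) - wt2 W (m n)).
  apply: (@le_trans _ _ ((b ^ rho.*2)%:R * (thr T0 (n %/ C) * #|A n|%:R))); last first.
    by apply: ler_wpM2l => //; rewrite lerBrDl run_gain.
  rewrite /load -mulr_sumr mulrCA ler_wpM2l ?thr_ge0 //.
  rewrite -natr_sum -natrM ler_nat.
  have -> : (\sum_u #|[set u' in A n | u \in ball W rho.*2 u']| =
             \sum_(u' in A n) #|ball W rho.*2 u'|)%N.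
    under eq_bigr => u _ do (rewrite -sum1_card; under eq_bigl => u' do rewrite inE).
    rewrite (exchange_big_dep (mem (A n))) => [|u u' _ /andP[]//] /=.
    apply: eq_bigr => u' uA; rewrite -sum1_card; apply: eq_bigl => u.
    by rewrite uA.
  rewrite mulnC -sum_nat_const; apply: leq_sum => u' _; exact: card_ball.
move: IH h; rewrite !mulrBr; lra.
Qed.

Lemma load_changed i u v : v \in ball W rho u -> m i.+1 v != m i v ->
  thr T0 (i %/ C) <= load i u.
Proof.
move=> vu /step_changed[]// u' u'A vu'.
rewrite /load ler_peMr ?thr_ge0 // ler1n; apply/card_gt0P; exists u'.
by rewrite inE u'A /= -addnn; apply: ball_cat vu' _; rewrite ball_symE.
Qed.

Lemma eq_chg (f g nu : I -> I) u : {in ball W rho u, f =1 g} ->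
  chg W rho u f nu = chg W rho u g nu.
Proof.
by move=> fg; apply: eq_forallb_in => v vu; rewrite fg.
Qed.

Lemma eq_gain (f g nu : I -> I) u : {in ball W rho u, f =1 g} ->
  gain W rho u f nu = gain W rho u g nu.
Proof. by move=> fg; apply: eq_bigr => v vu; rewrite fg. Qed.

(** Consider the step with threshold [j] and the colour of [u]. If an earlier step has changed the
    ball of [u], that step charged [u] a threshold at least as large. Otherwise the matching in the
    ball is still [mu], the change [nu] is still available, and [u] itself moves. *)
Lemma load_total u j (nu : {ffun I -> I}) : (j < J)%N ->
  active W rho (thr T0 j / theta) u ->
  chg W rho u mu nu -> thr T0 j <= gain W rho u mu nu ->
  thr T0 j <= \sum_(i < J * C) load i u.
Proof.
move=> jJ au cu gu.
have C0 : (0 < C)%N by apply: leq_ltn_trans (colC u).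
set i0 := (j * C + col u)%N.
have i0d : (i0 %/ C)%N = j by rewrite /i0 divnMDl // divn_small ?addn0.
have i0m : (i0 %% C)%N = col u by rewrite /i0 modnMDl modn_small.
have i0J : (i0 < J * C)%N by rewrite /i0; have := colC u; nia.
suff [i ii0 hi] : exists2 i, (i <= i0)%N & thr T0 j <= load i u.
  have iJ : (i < J * C)%N by lia.
  rewrite (bigD1 (Ordinal iJ)) //=; apply: le_trans hi _.
  by rewrite lerDl sumr_ge0 // => ? _; apply: load_ge0.
have [/existsP[i /existsP[v /andP[vu ne]]]|] :=
  boolP [exists i : 'I_i0, exists v, (v \in ball W rho u) && (m i.+1 v != m i v)].
  exists i; first exact: ltnW.
  apply: le_trans (load_changed vu ne); apply: thr_le.
  by rewrite -i0d leq_div2r // ltnW.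
rewrite negb_exists => /forallP h; exists i0 => //.
have mm : {in ball W rho u, m i0 =1 mu}.
  suff H i : (i <= i0)%N -> {in ball W rho u, m i =1 mu} by apply: H.
  elim: i => // i IH ii0 v vu; rewrite -(IH (ltnW ii0) v vu).
  have := h (Ordinal ii0); rewrite negb_exists => /forallP/(_ v).
  by rewrite vu /= negbK => /eqP.
rewrite /load i0d ler_peMr ?thr_ge0 // ler1n; apply/card_gt0P; exists u.
rewrite !inE ball_refl i0m i0d eqxx au /= andbT /improve.
by case: pickP => // /(_ nu); rewrite (eq_chg _ mm) (eq_gain _ mm) cu gu.
Qed.

Variable ms : I -> I.
Hypotheses (mms : mtch W ms) (msmax : forall f, mtch W f -> wt2 W f <= wt2 W ms).

(** A maximum matching is maximal: an edge with both ends single could be added. Changes skipped by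
    inactive centres can therefore be charged to [ms]. *)
Lemma max_covers x y : 0 < W x y -> exists2 z, z \in [set x; y] & 0 < W z (ms z).
Proof.
have [ims ems] := mms => xy.
have nxy : x != y by apply: contraTneq xy => ->; rewrite W0 ltxx.
have [hx|hx] := ems x; last by exists x; rewrite ?inE ?eqxx.
have [hy|hy] := ems y; last by exists y; rewrite ?inE ?eqxx ?orbT.
pose f v := if v == x then y else if v == y then x else ms v.
have mf : mtch W f.
  split=> v; rewrite /f.
    case: (eqVneq v x) => [->|vx]; first by rewrite eq_sym (negPf nxy) eqxx.
    case: (eqVneq v y) => [->|vy]; first by rewrite eqxx.
    case: eqVneq => [e|_]; first by move: vx; rewrite -[v]ims e hx eqxx.
    case: eqVneq => [e|_]; first by move: vy; rewrite -[v]ims e hy eqxx.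
    exact: ims.
  case: (eqVneq v x) => [->|vx]; first by right.
  by case: (eqVneq v y) => [->|vy]; first by right; rewrite sW.
have := msmax mf; rewrite leNgt => /negP[].
rewrite /wt2 (bigD1 x) //= [ltRHS](bigD1 x) //= hx W0 {1}/f eqxx.
apply: ltr_leD => //; apply: ler_sum => v vx; rewrite /f (negPf vx).
by case: eqP => // ->; rewrite hy W0.
Qed.

Definition best u : R :=
  \big[Num.max/0]_(nu : {ffun I -> I} | chg W rho u mu nu) gain W rho u mu nu.

Lemma best_ge u nu : chg W rho u mu nu -> gain W rho u mu nu <= best u.
Proof.
move=> cu; pose nu' := [ffun x => nu x].
have E v : nu' v = nu v by rewrite ffunE.
have -> : gain W rho u mu nu = gain W rho u mu nu'.
  by apply: eq_bigr => v _; rewrite E.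
rewrite /best (bigD1 nu') /= ?le_max ?lexx //.
by rewrite /chg; under eq_forallb_in => v _ do rewrite !E.
Qed.

(** Let [j] be the first threshold not above the gain, so that the gain is at most twice that
    threshold. Either [u] is active there and [load_total] pays, or [theta] times the weight of some
    [ms]-edge at a vertex of the ball pays. Gains below the last threshold are covered by [low]. *)
Lemma best_le u : best u <=
  2 * \sum_(i < J * C) load i u + 2 * theta * \sum_(z in ball W rho u) W z (ms z).
Proof.
set X := \sum_(i < _) _; set Y := \sum_(z in _) _.
have X0 : 0 <= X by apply: sumr_ge0 => i _; apply: load_ge0.
have Y0 : 0 <= Y by apply: sumr_ge0.
have tY0 : 0 <= theta * Y by rewrite mulr_ge0 // ltW.
have rhs0 : 0 <= 2 * X + 2 * theta * Y by lra.
rewrite /best; elim/big_ind: _ => // [x y hx hy|nu cu]; first by rewrite ge_max hx.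
set h := gain _ _ _ _ _; have [h0|h0] := leP h 0; first exact: le_trans h0 _.
have [x xu hx] : exists2 x, x \in ball W rho u & W x (mu x) < W x (nu x).
  have [/existsP[x /andP[]]|] :=
    boolP [exists x, (x \in ball W rho u) && (W x (mu x) < W x (nu x))]; first by exists x.
  rewrite negb_exists => /forallP H; move: h0; rewrite ltNge => /negP[].
  by apply: sumr_le0 => v vu; rewrite subr_le0; have := H v; rewrite vu /= -leNgt.
have xy : 0 < W x (nu x) by apply: le_lt_trans hx.
have yu : nu x \in ball W rho u.
  have /forall_inP/(_ x xu) := cu; case: ifP => [_ /and3P[]//|_ /eqP e].
  by move: hx; rewrite e ltxx.
have [z zxy zms] := max_covers xy.
have zu : z \in ball W rho u by move: zxy; rewrite !inE => /orP[] /eqP->.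
have zY : theta * W z (ms z) <= theta * Y.
  rewrite ler_pM2l // /Y (bigD1 z) //= lerDl; exact: sumr_ge0.
have lz := low zms.
have [hJ|hJ] := ltP h (thr T0 J); first by lra.
case: (ex_minnP (ex_intro (fun j => thr T0 j <= h) J hJ)) => j hj jmin.
have h2 : h <= 2 * thr T0 j.
  (* No threshold precedes [j = 0]. There the gain is at most the size of the ball because weights
     are at most 1; this explains the value of [T0]. *)
  case: j hj jmin => [|j] hj jmin.
    suff : h <= T0 by have := T0_ge0; rewrite /thr expr0 divr1; lra.
    rewrite T0E; apply: (@le_trans _ _ #|ball W rho u|%:R).
      rewrite -sum1_card natr_sum; apply: ler_sum => v _.
      by have := Wle1 v (nu v); have := Wge0 v (mu v); lra.
    by rewrite ler_nat card_ball.
  by rewrite -thrS leNgt; apply/negP => /ltW /jmin; rewrite ltnn.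
have [hz|hz] := leP (thr T0 j) (theta * W z (ms z)); first by lra.
have jJ : (j < J)%N.
  rewrite ltnNge; apply/negP => /thr_le; lra.
suff : thr T0 j <= X by lra.
apply: load_total cu hj => //; apply/exists_inP; exists z => //.
apply/existsP; exists (ms z); rewrite zms /= ler_pdivlMr // mulrC.
exact: ltW.
Qed.

(** The loads are paid by the growth of the weight, and each [W z (ms z)] is used by at most
    [b ^ rho] centres. *)
Lemma round_gain :
  k.*2%:R * wt2 W ms - (k.+1).*2%:R * wt2 W mu <=
  k.*2%:R * (2 * (b ^ rho.*2)%:R * (wt2 W (m (J * C)) - wt2 W mu)
             + 2 * theta * (b ^ rho)%:R * wt2 W ms).
Proof.
apply: le_trans (local_gain_sum W0 Wge0 mmu mms best_ge) _.
apply: ler_wpM2l; first by rewrite ler0n.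
apply: le_trans (ler_sum _ (fun u _ => best_le u)) _.
rewrite big_split -!mulr_sumr /= -!mulrA; apply: lerD.
  by apply: ler_wpM2l => //; apply: sum_load.
apply: ler_wpM2l => //; apply: ler_wpM2l; first exact: ltW.
rewrite (exchange_big_dep xpredT) //= /wt2 mulr_sumr; apply: ler_sum => z _.
rewrite sumr_const -[leLHS]mulr_natl ler_wpM2r // ler_nat.
have -> : #|(fun u => z \in ball W rho u)| = #|ball W rho z|.
  by apply: eq_card => u; rewrite -topredE /= ball_symE.
exact: card_ball.
Qed.

End Rounds.

(** * Approximation and locality of the local search *)

Section Approximation.
Variables (R : realType) (I : finType) (W : I -> I -> R) (q b C J : nat).
Variables (col : I -> nat) (T0 theta : R).

Let k := (4 * q)%N.
Let rho := k.*2.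

Hypotheses (sW : wsym W) (W0 : forall v, W v v = 0) (Wge0 : forall u v, 0 <= W u v).
Hypotheses (Wle1 : forall u v, W u v <= 1) (degW : forall v, (#|nb W v| < b)%N).
Hypotheses (pcol : proper_col W rho.*2 col) (colC : forall v, (col v < C)%N).
Hypotheses (q0 : (0 < q)%N) (b0 : (0 < b)%N).
Hypotheses (T0E : T0 = (b ^ rho)%:R) (thetaE : theta = (16 * q * b ^ rho)%:R^-1).
Hypothesis low : forall u v, 0 < W u v -> thr T0 J <= theta * W u v.

Let rnd := run W k C col T0 theta (J * C).
Let N := (2 * b ^ rho.*2)%N.

Lemma rounds_mtch r : mtch W (iter r rnd id).
Proof.
elim: r => [|r IH]; first by split=> // v; left.
exact: run_mtch.
Qed.

(** Each sweep removes a fraction [1/N] of the deficit [y]. With [d = 1/(8q)], the end result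
    [y <= d * X] means [(1 - 2d) X <= (1 + 2d) x], and [x <= X] turns this into [x >= (1 - 4d) X],
    where [4d = 1/(2q)]. *)
Lemma rounds_approx ms : mtch W ms ->
  ((2 * q)%N%:R - 1) * wt2 W ms <= (2 * q)%N%:R * wt2 W (iter (N * (8 * q)) rnd id).
Proof.
have [ms' mms msmax] := max_mtch W => mms'.
have q1 : 1 <= q%:R :> R by rewrite ler1n.
apply: (@le_trans _ _ (((2 * q)%N%:R - 1) * wt2 W ms')).
  by apply: ler_wpM2l (msmax _ mms'); rewrite natrM; lra.
set X := wt2 W ms'; pose x r := wt2 W (iter r rnd id).
have N0 : 1 <= N%:R :> R by rewrite ler1n muln_gt0 expn_gt0 b0.
have theta0 : 0 < theta by rewrite thetaE invr_gt0 ltr0n !muln_gt0 expn_gt0 b0 q0.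
have X0 : 0 <= X by apply: sumr_ge0.
have x0 r : 0 <= x r by apply: sumr_ge0.
have Q0 : q%:R != 0 :> R by rewrite pnatr_eq0 -lt0n.
(* Both errors of a sweep are multiples of [d]: [1/k] is [2 * d], and [theta] is chosen such that
   the skipped changes cost [d * X]. *)
pose d : R := (8 * q%:R)^-1.
have dq : d * q%:R = 8^-1 by rewrite /d; field.
have d0 : 0 < d by rewrite invr_gt0; lra.
have xS r : (1 - d) * X - (1 + 2 * d) * x r <= N%:R * (x r.+1 - x r).
  have := round_gain sW W0 Wge0 Wle1 degW pcol colC T0E theta0 low (rounds_mtch r) mms msmax.
  have -> : 2 * theta * (b ^ k.*2)%:R = d :> R.
    rewrite thetaE /d !natrM; field; rewrite Q0 /=.
    by rewrite pnatr_eq0 -lt0n expn_gt0 b0.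
  rewrite -/X -/(x r) -[wt2 W (run _ _ _ _ _ _ _ _)]/(x r.+1) -/rho.
  have -> : 2 * (b ^ rho.*2)%:R = N%:R :> R by rewrite natrM.
  have -> : k.*2%:R = 8 * q%:R :> R by rewrite /k -natrM; congr (_%:R); lia.
  have -> : k.+1.*2%:R = 8 * q%:R + 2 :> R.
    by rewrite -natrM -natrD; congr (_%:R); rewrite /k; lia.
  set y := N%:R * _ => h; rewrite -subr_ge0.
  have q8 : 0 < 8 * q%:R :> R by lra.
  rewrite -(pmulr_rge0 _ q8).
  have -> : 8 * q%:R * (y - ((1 - d) * X - (1 + 2 * d) * x r)) =
     8 * q%:R * y - 8 * q%:R * X + 8 * (d * q%:R) * X + 8 * q%:R * x r
      + 16 * (d * q%:R) * x r by ring.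
  have e1 : 8 * q%:R * (y + d * X) = 8 * q%:R * y + 8 * (d * q%:R) * X by ring.
  by move: h; rewrite e1 dq; lra.
have mono r : x r <= x r.+1.
  exact: run_mono T0E _ _.
pose y r := (1 - d) * X - (1 + 2 * d) * x r.
have yX r : y r <= X.
  have := mulr_ge0 (ltW d0) X0; have := mulr_ge0 (ltW d0) (x0 r); have := x0 r.
  by rewrite /y; lra.
have yS r : y r.+1 * N%:R <= y r * (N%:R - 1).
  have h := xS r; have hm := mono r.
  have : 0 <= d * N%:R * (x r.+1 - x r).
    by rewrite !mulr_ge0 ?(ltW d0) ?subr_ge0 // ltW // (lt_le_trans _ N0).
  rewrite -/(y r) in h.
  have -> : y r.+1 = y r - (1 + 2 * d) * (x r.+1 - x r) by rewrite /y; ring.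
  lra.
(* Harmonic decay is used in place of the geometric one. After [8 * q * N] sweeps it leaves
   [X / (1 + 8q)], which is below [d * X]. *)
have yb r : y r * (N + r)%:R <= N%:R * X.
  elim: r => [|r IH]; first by rewrite addn0 mulrC ler_wpM2l // (le_trans _ N0).
  have NX : y r.+1 * (N + r)%:R <= (N%:R - 1) * X.
    have Np : 0 < N%:R :> R by lra.
    rewrite -(ler_pM2l Np) mulrA [N%:R * y _]mulrC.
    apply: (@le_trans _ _ (y r * (N%:R - 1) * (N + r)%:R)); first by rewrite ler_wpM2r.
    have N1 : 0 <= N%:R - 1 :> R by lra.
    have := ler_wpM2l N1 IH; lra.
  have := yX r.+1; rewrite addnS -natr1 mulrDr mulr1; lra.
set K := (N * (8 * q))%N.
have yK : y K <= d * X.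
  have [yK|yK] := leP (y K) 0; first by apply: le_trans yK _; rewrite mulr_ge0 // ltW.
  have := yb K.
  have -> : (N + K)%:R = N%:R * (1 + 8 * q%:R) :> R.
    by rewrite natrD !natrM; ring.
  rewrite mulrCA ler_pM2l; last by lra.
  have q8 : 0 < 8 * q%:R :> R by lra.
  rewrite -(ler_pM2l q8) => h.
  have -> : d * X = X / (8 * q%:R) by rewrite mulrC.
  rewrite ler_pdivlMr //.
  have := mulr_gt0 yK q8; move: h; rewrite ler_pM2l // => h; lra.
move: yK; rewrite /y -/(x K) => h.
have q8 : 0 < 8 * q%:R :> R by lra.
move: h; rewrite -(ler_pM2l q8).
have -> : 8 * q%:R * ((1 - d) * X - (1 + 2 * d) * x K) =
   8 * q%:R * X - 8 * (d * q%:R) * X - 8 * q%:R * x K - 16 * (d * q%:R) * x K by ring.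
have -> : 8 * q%:R * (d * X) = 8 * (d * q%:R) * X by ring.
rewrite dq natrM => h.
have xX : x K <= X by apply: msmax; apply: rounds_mtch.
lra.
Qed.

End Approximation.

(** * The radius on which the result of the local search depends *)

Section Locality.
Variables (R : realType) (I : finType) (wm : R).

(** The condition is asymmetric: only [W] has weights bounded below by [wm]. The matrix [W'] stands
    for any competing network with the same view, which may contain much lighter edges elsewhere. *)
Definition local (r : nat) (T : Type) (f : (I -> I -> R) -> I -> T) :=
  forall W W' i, (forall x y, 0 < W x y -> wm <= W x y) ->
  agree W W' r i -> f W i = f W' i.

Lemma local_le r s T (f : (I -> I -> R) -> I -> T) :
  (r <= s)%N -> local r f -> local s f.
Proof. by move=> rs lf W W' i Wm /(agree_le rs); apply: lf. Qed.

Variables (rho : nat) (colF : (I -> I -> R) -> I -> nat).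

Lemma agree_active (W W' : I -> I -> R) s u : agree W W' rho u ->
  active W rho s u = active W' rho s u.
Proof.
move=> ag; rewrite /active -(agree_ball ag); apply: eq_existsb => x.
by case xu: (x \in _) => //=; apply: eq_existsb => y; rewrite ag.
Qed.

(** A vertex has to know the state in the balls of all centres that may affect it; these balls reach
    up to distance [rho.*2]. *)
Lemma local_step r F tau s c : local r colF -> local r F ->
  local (r + rho.*2) (fun W => step W rho (colF W) tau s c (F W)).
Proof.
move=> lcol lF W W' v Wm ag; rewrite /step.
have bv : ball W rho v = ball W' rho v by apply: agree_ball; apply: agree_le ag; lia.
have agu u : u \in ball W rho v -> agree W W' (rho + r) u.
  by move=> uv; apply: (agree_sub uv); apply: agree_le ag; lia.
have agu' u : u \in ball W rho v -> agree W W' rho u.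
  by move=> /agu; apply: agree_le; lia.
have Fv : F W v = F W' v by apply: lF => //; apply: agree_le ag; lia.
have -> : [pick u | [&& u \in ball W rho v, colF W u == c & active W rho s u]] =
          [pick u | [&& u \in ball W' rho v, colF W' u == c & active W' rho s u]].
  apply: eq_pick => u; rewrite /= -bv; case uv: (u \in _) => //=.
  rewrite (agree_active _ (agu' _ uv)); congr ((_ == _) && _).
  by apply: lcol => //; apply: agree_le (agu _ uv); lia.
case: pickP => // u /and3P[]; rewrite -bv => uv _ _.
suff -> : improve W rho tau u (F W) = improve W' rho tau u (F W').
  by case: improve => // _.
have bu := agree_ball (agu' _ uv).
have Fx x : x \in ball W rho u -> F W x = F W' x.
  by move=> xu; apply: lF => //; apply: (agree_sub xu); apply: agu.
have gE (nu : {ffun I -> I}) : gain W rho u (F W) nu = gain W' rho u (F W') nu.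
  by rewrite /gain -bu; apply: eq_bigr => x xu; rewrite Fx // !(agu' _ uv).
apply: eq_pick => nu /=; rewrite gE; congr (_ && _).
rewrite /chg -bu; apply: eq_forallb_in => x xu.
by rewrite Fx // (agu' _ uv).
Qed.

(** In [W] no centre is active. Activity is decided by the ball of the centre, so near [v] none is
    active in [W'] either, and the radius does not grow. *)
Lemma local_step_idle r F tau s c : s < wm -> (rho.*2 <= r)%N -> local r F ->
  local r (fun W => step W rho (colF W) tau s c (F W)).
Proof.
move=> sm rr lF W W' v Wm ag.
have agu u : u \in ball W rho v -> agree W W' rho u.
  by move=> uv; apply: (agree_sub uv); apply: agree_le ag; lia.
have act0 u : active W rho s u = false.
  apply/negbTE/negP => /exists_inP[x _ /existsP[y /andP[/Wm h1 h2]]].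
  by have := le_trans h1 h2; rewrite leNgt sm.
have bv : ball W rho v = ball W' rho v by apply: agree_ball; apply: agree_le ag; lia.
rewrite /step; case: pickP => [u|_]; first by rewrite act0 !andbF.
case: pickP => [u|_]; last exact: lF.
by rewrite -bv => /and3P[uv _]; rewrite -(agree_active _ (agu _ uv)) act0.
Qed.

End Locality.

Section LocalityRounds.
Variables (R : realType) (I : finType) (wm : R) (k C J Ja : nat).
Variables (colF : (I -> I -> R) -> I -> nat) (T0 theta : R).
Let rho := k.*2.
Hypothesis idle : forall j, (Ja <= j)%N -> thr T0 j / theta < wm.

(** Only the first [Ja * C] steps enlarge the radius; all later ones are idle. *)
Lemma local_run r F i : (0 < C)%N -> (rho.*2 <= r)%N ->
  local wm r colF -> local wm r F ->
  local wm (r + rho.*2 * minn i (Ja * C))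
    (fun W => run W k C (colF W) T0 theta i (F W)).
Proof.
move=> C0 rr lc lF; elim: i => [|i IH]; first by rewrite min0n muln0 addn0.
case: (ltnP i (Ja * C)) => iJ.
  have -> : (r + rho.*2 * minn i.+1 (Ja * C) =
             r + rho.*2 * minn i (Ja * C) + rho.*2)%N.
    by rewrite (minn_idPl iJ) (minn_idPl (ltnW iJ)) mulnS; lia.
  by apply: local_step IH => //; apply: local_le lc; lia.
have -> : minn i.+1 (Ja * C) = minn i (Ja * C) by lia.
apply: local_step_idle IH; last by lia.
by apply: idle; rewrite leq_divRL.
Qed.

Lemma local_rounds r K : (0 < C)%N -> (rho.*2 <= r)%N -> local wm r colF ->
  local wm (r + K * (rho.*2 * (Ja * C)))
    (fun W => iter K (run W k C (colF W) T0 theta (J * C)) id).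
Proof.
move=> C0 rr lc; elim: K => [|K IH]; first by [].
have lc' : local wm (r + K * (rho.*2 * (Ja * C))) colF by apply: local_le lc; lia.
have rr' : (rho.*2 <= r + K * (rho.*2 * (Ja * C)))%N by lia.
move=> W W' i Wm ag; apply: (local_run (i := (J * C)%N) C0 rr' lc' IH) Wm _.
apply: agree_le ag.
by rewrite mulSn -addnA leq_add2l addnC leq_add2r leq_mul2l geq_minr orbT.
Qed.

End LocalityRounds.

(** * Colour reduction *)

Lemma bits_inj a c c' : (c < 2 ^ a)%N -> (c' < 2 ^ a)%N ->
  (forall i, (i < a)%N -> odd (c %/ 2 ^ i) = odd (c' %/ 2 ^ i)) -> c = c'.
Proof.
elim: a c c' => [|a IH] c c'; first by rewrite expn0; lia.
rewrite expnS => ca c'a h.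
have h0 : odd c = odd c' by have := h 0%N isT; rewrite !divn1.
suff : (c %/ 2 = c' %/ 2)%N by lia.
apply: IH; [lia|lia|move=> i ia].
by have := h i.+1 ia; rewrite expnS !divnMA.
Qed.

(* Colour c is read as the polynomial over GF(2^e) whose coefficients are the
   bits of c; the new colour is a point where it differs from the polynomials of
   the colours in s, together with its value there. *)
Lemma colour_reduction (z a e : nat) : (2 ^ z * a < 2 ^ e)%N ->
  exists Phi : nat -> seq nat -> nat,
  (forall c s, (Phi c s < 2 ^ e.*2)%N) /\
  forall c c' s s', c != c' -> (size s <= 2 ^ z)%N -> (size s' <= 2 ^ z)%N ->
    {in c :: s, forall x, (x < 2 ^ a)%N} -> {in c' :: s', forall x, (x < 2 ^ a)%N} ->
    c' \in s -> c \in s' -> Phi c s != Phi c' s'.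
Proof.
case: (posnP e) => [->|e0 zae].
  rewrite ltnS leqn0 muln_eq0 expn_eq0 /= => /eqP->.
  exists (fun _ _ => 0%N); split=> // c c' s s' ne _ _ h h' _ _.
  have := h c (mem_head _ _); have := h' c' (mem_head _ _).
  by rewrite !ltnS !leqn0 => /eqP e1 /eqP e2; rewrite e1 e2 eqxx in ne.
have [F _ cF] := pPrimePowerField (isT : prime 2) e0.
pose pc c : {poly F} := \poly_(i < a) (odd (c %/ 2 ^ i))%:R.
have pc_inj c c' : (c < 2 ^ a)%N -> (c' < 2 ^ a)%N -> pc c = pc c' -> c = c'.
  move=> ca ca' e1; apply: (bits_inj ca ca') => i ia.
  have := congr1 (fun p : {poly F} => p`_i) e1; rewrite !coef_poly ia.
  by do 2 case: odd => //; move/eqP; rewrite ?oner_eq0 // eq_sym oner_eq0.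
(* A ball contains its centre, so the colour [c] itself occurs in [s] and has to be skipped. *)
pose ok c s x := all (fun d => (d == c) || ((pc c).[x] != (pc d).[x])) s.
pose pt c s : F := odflt 0 [pick x | ok c s x].
pose cd (xy : F * F) : nat := enum_rank xy.
have cd_inj : injective cd by move=> x y /val_inj /enum_rank_inj.
have ptP c s : (size s <= 2 ^ z)%N -> {in c :: s, forall x, (x < 2 ^ a)%N} ->
    ok c s (pt c s).
  move=> ss sa; rewrite /pt; case: pickP => //= nok; exfalso.
  (* Two distinct polynomials with [a] coefficients agree at fewer than [a] points unless [a] is too
     small to matter, so the bad points number at most [2 ^ z * a], less than the size of the
     field. *)
  pose bad d := if d == c then set0 else [set x : F | (pc c).[x] == (pc d).[x]].
  have badE : \bigcup_(d <- s) bad d = setT.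
    apply/setP=> x; rewrite inE; have := nok x; rewrite /ok => /negbT.
    case/allPn => d ds; rewrite negb_or negbK => /andP[dc /eqP xd].
    rewrite (big_rem d ds) /= inE /bad (negPf dc) inE xd eqxx //.
  have badle d : d \in s -> (#|bad d| <= a)%N.
    move=> ds; rewrite /bad; case: eqP => [_|/eqP dc]; first by rewrite cards0.
    have p0 : pc c - pc d != 0.
      rewrite subr_eq0; apply: contraNneq dc => /pc_inj->; rewrite ?sa ?mem_head //.
      by rewrite inE ds orbT.
    rewrite cardE; set rs := enum _.
    have h : (size rs < size (pc c - pc d)%R)%N.
      apply: max_poly_roots => //; last exact: enum_uniq.
      apply/allP => x; rewrite mem_enum inE /root hornerD hornerN subr_eq0 //.
    have : (size (pc c - pc d)%R <= a)%N.
      rewrite (leq_trans (size_polyD _ _)) // size_polyN geq_max.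
      by rewrite !size_poly.
    move: h; lia.
  have : (#|\bigcup_(d <- s) bad d| <= size s * a)%N.
    rewrite big_seq -sum1_size big_seq big_distrl /=.
    elim/big_rec2: _ => [|d A m ds h]; first by rewrite cards0.
    by rewrite (leq_trans (leq_card_setU _ _)) // mul1n leq_add // badle.
  rewrite badE cardsT cF; have := leq_mul2r a (size s) (2 ^ z).
  rewrite ss orbT; lia.
exists (fun c s => cd (pt c s, (pc c).[pt c s])); split.
  move=> c s; apply: leq_trans (ltn_ord _) _.
  by rewrite card_prod cF -expnD addnn.
move=> c c' s s' cc' ss ss' sa sa' cs cs'; apply/eqP => /cd_inj[e1 e2].
have /allP/(_ _ cs) := ptP _ _ ss sa; rewrite eq_sym (negPf cc') /=.
by rewrite e2 e1 eqxx.
Qed.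

(** Bit length of the colours after one reduction of colours with [a] bits. It is doubled because a
    new colour is a pair of field elements. *)
Definition next_exp (z a : nat) : nat := (z + trunc_log 2 a).+1.*2.

Lemma next_exp_lt z a : (2 ^ z * a < 2 ^ (z + trunc_log 2 a).+1)%N.
Proof.
by rewrite -addnS expnD ltn_pmul2l ?expn_gt0 // trunc_log_ltn.
Qed.

Definition recolour z a : nat -> seq nat -> nat :=
  projT1 (cid (colour_reduction (next_exp_lt z a))).

Section Colouring.
Variables (R : realType) (I : finType) (idn : I -> nat) (z tau a0 : nat).
Hypotheses (idn_inj : injective idn) (idn_lt : forall i, (idn i < 2 ^ a0)%N).

Definition exps t := iter t (next_exp z) a0.

Fixpoint colour t (W : I -> I -> R) i : nat :=
  if t is t'.+1 then
    recolour z (exps t') (colour t' W i) [seq colour t' W j | j <- enum (ball W tau i)]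
  else idn i.

Lemma colour_lt t W i : (colour t W i < 2 ^ exps t)%N.
Proof.
case: t => [|t] /=; first exact: idn_lt.
by rewrite /recolour; case: cid => Phi [h _] /=; apply: h.
Qed.

Lemma colour_proper t W : wsym W -> (forall i, (#|ball W tau i| <= 2 ^ z)%N) ->
  proper_col W tau (colour t W).
Proof.
move=> sW bW; elim: t => [|t IH] u v vu; first exact: idn_inj.
move/eqP; apply: contraTeq => uv /=.
rewrite /recolour; case: cid => Phi [_ h] /=.
have rng x y : y \in colour t W x :: [seq colour t W j | j <- enum (ball W tau x)] ->
    (y < 2 ^ exps t)%N.
  by rewrite inE => /orP[/eqP->|/mapP[j _ ->]]; apply: colour_lt.
apply: h.
- by apply: contraNneq uv => /(IH _ _ vu)->.
- by rewrite size_map -cardE.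
- by rewrite size_map -cardE.
- by move=> y; apply: rng.
- by move=> y; apply: rng.
- by apply: map_f; rewrite mem_enum.
- by apply: map_f; rewrite mem_enum ball_symE.
Qed.

Lemma colour_local wm t : local wm (t * tau) (colour t).
Proof.
elim: t => [|t IH] W W' i Wm ag //=.
rewrite (IH _ W') //; last by apply: agree_le ag; rewrite mulSn leq_addl.
congr recolour; rewrite -(agree_ball (agree_le _ ag)) ?mulSn ?leq_addr //.
apply/eq_in_map => j; rewrite mem_enum => ji; apply: IH => //.
by apply: (agree_sub ji); rewrite -mulSn.
Qed.

End Colouring.

(** * Iterated logarithms *)

Section Logs.
Variable R : realType.
Implicit Types x y : R.

(** Follows from [exp (- 1/2) >= 1 - 1/2]. *)
Lemma ln2_ge : 2^-1 <= ln 2 :> R.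
Proof.
rewrite -[leLHS]expRK ler_ln ?posrE ?expR_gt0 //.
have := expR_ge1Dx (- 2^-1 : R); rewrite expRN => h.
have e0 := expR_gt0 (2^-1 : R).
rewrite -[leRHS]invrK -[leLHS]invrK lef_pV2 ?posrE ?invr_gt0 //.
by apply: le_trans h; lra.
Qed.

Lemma ln2_gt0 : 0 < ln 2 :> R. Proof. by have := ln2_ge; lra. Qed.

Lemma log2M x y : 0 < x -> 0 < y -> log2 (x * y) = log2 x + log2 y.
Proof. by move=> x0 y0; rewrite /log2 lnM ?posrE // mulrDl. Qed.

Lemma log2X n : log2 (2 ^+ n : R) = n%:R.
Proof. by rewrite /log2 lnXn // -[_ *+ n]mulr_natl mulfK // gt_eqF // ln2_gt0. Qed.

Lemma log2_le x y : 0 < x -> x <= y -> log2 x <= log2 y.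
Proof.
move=> x0 xy; have y0 := lt_le_trans x0 xy.
by rewrite /log2 ler_pM2r ?invr_gt0 ?ln2_gt0 // ler_ln ?posrE.
Qed.

Lemma log2_lt x y : 0 < x -> x < y -> log2 x < log2 y.
Proof.
move=> x0 xy; have y0 := lt_trans x0 xy.
by rewrite /log2 ltr_pM2r ?invr_gt0 ?ln2_gt0 // ltr_ln ?posrE.
Qed.

Lemma log2_1 : log2 (1 : R) = 0.
Proof. by rewrite /log2 ln1 mul0r. Qed.

Lemma log2_2 : log2 (2 : R) = 1.
Proof. by have := log2X 1; rewrite expr1. Qed.

(** Iterating [log2] loses at least 1 per step as long as the value is at least 2, so the search
    range in [logstar] suffices. *)
Lemma log2_subn x : 2 <= x -> log2 x <= x - 1.
Proof.
move=> x2; have -> : x = 2 * (1 + (x / 2 - 1)) by field.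
rewrite log2M //; last by lra.
rewrite log2_2 /log2.
have h : ln (1 + (x / 2 - 1)) <= x / 2 - 1 by apply: le_ln1Dx; lra.
suff : ln (1 + (x / 2 - 1)) / ln 2 <= 2 * (x / 2 - 1) by lra.
rewrite ler_pdivrMr ?ln2_gt0 //; apply: le_trans h _.
by have := ln2_ge; nra.
Qed.

Lemma trunc_log_le (a : nat) x : 1 <= x -> a%:R <= x -> (trunc_log 2 a)%:R <= log2 x.
Proof.
move=> x1 ax; rewrite -log2X; apply: log2_le; first exact: exprn_gt0.
case: (posnP a) => [->|a0]; first by rewrite trunc_log0 expr0.
by apply: le_trans ax; rewrite -natrX ler_nat trunc_logP.
Qed.

Lemma logstar_has n :
  has (fun i => iter i (@log2 R) n%:R <= 1) (iota 0 n.+1).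
Proof.
apply: contraT => /hasPn h.
have h1 i : (i <= n)%N -> 1 < iter i (@log2 R) n%:R.
  by move=> i_n; rewrite ltNge h // mem_iota.
have h2 i : (i <= n)%N -> iter i (@log2 R) n%:R <= n%:R - i%:R.
  elim: i => [|i IH] i_n; first by rewrite subr0.
  have hi := IH (ltnW i_n); have := h1 _ i_n; rewrite iterS => l1.
  set x := iter i _ _ in hi l1 *.
  have x1 : 1 < x by apply: h1; apply: ltnW.
  have x2 : 2 <= x.
    rewrite leNgt; apply/negP => x2; have : log2 x < log2 2 by apply: log2_lt; lra.
    by rewrite log2_2; lra.
  by have := log2_subn x2; rewrite -natr1; lra.
by have := h1 n (leqnn _); have := h2 n (leqnn _); rewrite subrr; lra.
Qed.

Lemma logstar_end n : iter (logstar R n) (@log2 R) n%:R <= 1.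
Proof.
have := nth_find 0%N (logstar_has n); rewrite nth_iota ?add0n //.
by have := logstar_has n; rewrite has_find size_iota.
Qed.

Lemma logstar_before n i : (i < logstar R n)%N -> 1 < iter i (@log2 R) n%:R.
Proof.
move=> il; have := before_find 0%N il; rewrite nth_iota ?add0n.
  by move/negbT; rewrite -ltNge.
by have := logstar_has n; rewrite has_find size_iota => /(ltn_trans il).
Qed.

Lemma logstar_gt0 n : (1 < n)%N -> (0 < logstar R n)%N.
Proof.
move=> n1; rewrite lt0n; apply/negP => /eqP e.
by have := logstar_end n; rewrite e /= leNgt ltr1n n1.
Qed.

(** A reduction takes [a] bits to about [2 * (z + log2 a)], so up to a factor the bit lengths follow
    the iterated logarithms of [n]. Identifiers start with about [k * log2 n] bits, one logarithm
    ahead, which explains the predecessor of [logstar]. *)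
Lemma exps_bound n k z : (1 < n)%N ->
  (exps z (k * (trunc_log 2 n).+1).+1 (logstar R n).-1 <= 2 ^ (k + 5) * z.+1)%N.
Proof.
move=> n1; set a0 := (_.+1); set T := _.-1.
have Tl : (T < logstar R n)%N by rewrite /T; have := logstar_gt0 n1; lia.
pose L t : R := iter t.+1 (@log2 R) n%:R.
(* This power gives [k + 1 <= c] for the start and [4 + 2 * log2 c <= c] for the induction. The
   final factor [L T + 1 <= 2] raises the exponent to [k + 5]. *)
set c : R := 2 ^+ (k + 4).
have ck : k%:R + 1 <= c.
  rewrite /c -natrX natr1 ler_nat expnD.
  have := ltn_expl k (isT : (1 < 2)%N); lia.
have c2 : 4 + 2 * log2 c <= c.
  rewrite log2X /c -natrX -natrM -natrD ler_nat expnD.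
  have := ltn_expl k (isT : (1 < 2)%N); lia.
have c1 : 1 <= c by rewrite /c -natrX ler1n expn_gt0.
have c0 : 0 <= log2 c by rewrite log2X.
have zz : log2 (z.+1%:R : R) <= z%:R.
  by rewrite -[leRHS]log2X; apply: log2_le; rewrite ?ltr0n // -natrX ler_nat ltn_expl.
suff H t : (t <= T)%N -> (exps z a0 t)%:R <= c * z.+1%:R * (L t + 1).
  rewrite -(ler_nat R); apply: le_trans (H T (leqnn _)) _.
  have LT : L T <= 1.
    have -> : L T = iter (logstar R n) (@log2 R) n%:R by rewrite /L /T prednK // logstar_gt0.
    exact: logstar_end.
  rewrite natrM natrX -addn1 (addnA k 4 1) exprD expr1 -/c.
  have : 0 <= c * z.+1%:R by rewrite mulr_ge0 //; lra.
  by nra.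
elim: t => [|t IH] tT.
  have n2 : 2 <= n%:R :> R by rewrite ler_nat.
  have l1 : 1 <= log2 (n%:R : R) by rewrite -[leLHS]log2_2; apply: log2_le.
  have tl : (trunc_log 2 n)%:R <= log2 n%:R :> R by apply: trunc_log_le => //; lra.
  have -> : exps z a0 0 = a0 by [].
  have -> : L 0%N = log2 n%:R by [].
  rewrite /a0 -natr1 natrM -natr1.
  have z1 : 1 <= z.+1%:R :> R by rewrite ler1n.
  have k0 : 0 <= k%:R :> R by [].
  apply: (@le_trans _ _ (c * (log2 n%:R + 1))).
    by nra.
  by rewrite -mulrA ler_pM2l; [nra|lra].
have := IH (ltnW tT); set a := exps z a0 t => ha.
have L1 : 1 < L t by apply: logstar_before; lia.
have l0 : 0 < log2 (L t) by rewrite -[ltLHS]log2_1; apply: log2_lt.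
have -> : L t.+1 = log2 (L t) by [].
have -> : exps z a0 t.+1 = next_exp z a by [].
have z1 : 1 <= z.+1%:R :> R by rewrite ler1n.
have cz : 1 <= c * z.+1%:R by nra.
have tl : (trunc_log 2 a)%:R <= log2 c + log2 z.+1%:R + log2 (L t + 1).
  by rewrite -!log2M; [apply: trunc_log_le => //; nra|lra..|nra|lra].
have lL : log2 (L t + 1) <= 1 + log2 (L t).
  have -> : 1 + log2 (L t) = log2 (2 * L t) by rewrite log2M ?log2_2 //; lra.
  by apply: log2_le; lra.
rewrite /next_exp -muln2 natrM -natr1 natrD.
have zE : z.+1%:R = z%:R + 1 :> R by rewrite -natr1.
have z0 : 0 <= z%:R :> R by [].
rewrite zE; set l := log2 (L t) in l0 lL *; set lc := log2 c in c0 c2 tl.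
have h1 : (z%:R + (trunc_log 2 a)%:R + 1) * 2 <= 4 * z%:R + 4 + 2 * lc + 2 * l by lra.
apply: le_trans h1 _.
have c4 : 4 <= c by lra.
have p1 : 0 <= (c - 4) * z%:R by rewrite mulr_ge0 // subr_ge0.
have p2 : 0 <= (c - 4) * l by rewrite mulr_ge0 ?subr_ge0 // ltW.
have c0' : 0 <= c by lra.
have p3 : 0 <= c * (z%:R * l) by apply: mulr_ge0 => //; apply: mulr_ge0 => //; apply: ltW.
lra.
Qed.

End Logs.

(** * The schedule of the algorithm *)

Section Schedule.
Variables (R : realType) (k : nat).
Implicit Types (eps wm : R) (n Delta : nat).

(* Balls of radius t have at most b^t vertices. There are C colours, K sweeps and
   J thresholds T0/2^j; only the first act thresholds have an effect when all
   weights are at least wm. Q is T0/theta. *)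
Definition par_q eps : nat := (Num.truncn eps^-1).+1.
Definition par_y Delta : nat := (trunc_log 2 Delta).+1.
Definition par_b Delta : nat := 2 ^ par_y Delta.
Definition par_rho eps : nat := (4 * par_q eps).*2.
(** Since [par_b] is a power of 2, [2 ^ par_z] equals the bound on the balls in which colours have
    to differ. *)
Definition par_z Delta eps : nat := par_y Delta * (par_rho eps).*2.
Definition par_C Delta eps : nat := 2 ^ (2 ^ (k + 5) * (par_z Delta eps).+1).
Definition par_K Delta eps : nat :=
  2 * par_b Delta ^ (par_rho eps).*2 * (8 * par_q eps).
Definition par_T0 Delta eps : R := (par_b Delta ^ par_rho eps)%:R.
Definition par_theta Delta eps : R :=
  (16 * par_q eps * par_b Delta ^ par_rho eps)%:R^-1.
Definition par_Q Delta eps : nat := 16 * par_q eps * par_b Delta ^ (par_rho eps).*2.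
Definition par_J n Delta eps : nat := par_Q Delta eps * n * par_q eps.
Definition par_act Delta eps wm : nat :=
  par_Q Delta eps + (Num.truncn (log2 wm^-1)).+1.

Definition par_radius n Delta eps wm : nat :=
  (logstar R n).-1 * (par_rho eps).*2 + (par_rho eps).*2 +
  par_K Delta eps * ((par_rho eps).*2 * (par_act Delta eps wm * par_C Delta eps)).

(* The view after t.+1 rounds determines the weights of the edges at distance at
   most t. *)
Definition par_rounds n Delta eps wm : nat :=
  if (Delta <= 1)%N then 0%N else (par_radius n Delta eps wm).+1.

Lemma par_q_gt0 eps : (0 < par_q eps)%N. Proof. by []. Qed.

Lemma par_b_gt0 Delta : (0 < par_b Delta)%N.
Proof. by rewrite /par_b expn_gt0. Qed.

Lemma par_q_gt eps : eps^-1 < (par_q eps)%:R.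
Proof. exact: truncnS_gt. Qed.

Lemma par_q_le eps : 0 < eps < 1 -> (par_q eps)%:R <= 2 * eps^-1.
Proof.
case/andP=> e0 e1; have i1 : 1 <= eps^-1 by rewrite invf_ge1 // ltW.
have : (Num.truncn eps^-1)%:R <= eps^-1 by rewrite truncn_le; lra.
by rewrite /par_q -natr1; lra.
Qed.

Lemma par_QE Delta eps :
  (par_Q Delta eps)%:R = par_T0 Delta eps / par_theta Delta eps.
Proof.
rewrite /par_T0 /par_theta invrK -natrM.
suff -> : par_Q Delta eps =
  (par_b Delta ^ par_rho eps * (16 * par_q eps * par_b Delta ^ par_rho eps))%N by [].
by rewrite /par_Q -addnn expnD mulnA mulnC.
Qed.

Lemma par_theta_gt0 Delta eps : 0 < par_theta Delta eps.
Proof. by rewrite invr_gt0 ltr0n 2!muln_gt0 par_q_gt0 expn_gt0 par_b_gt0. Qed.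

(** The crude estimate [J <= 2 ^ J] is affordable, because [par_J] does not enter [par_radius]. *)
Lemma par_low n Delta eps w : 0 < eps -> (0 < n)%N -> eps / n%:R <= w ->
  thr (par_T0 Delta eps) (par_J n Delta eps) <= par_theta Delta eps * w.
Proof.
move=> e0 n0 ew; have th0 := par_theta_gt0 Delta eps.
rewrite mulrC -ler_pdivrMr // /thr mulrAC -par_QE //.
rewrite ler_pdivrMr ?exprn_gt0 //.
have n0' : 0 < n%:R :> R by rewrite ltr0n.
have h : (par_J n Delta eps)%:R <= 2 ^+ par_J n Delta eps :> R.
  by rewrite -natrX ler_nat ltnW // ltn_expl.
have eq1 : 1 <= eps * (par_q eps)%:R.
  by rewrite -ler_pdivrMl // mulr1 ltW // par_q_gt.
have w0 : 0 < w by apply: lt_le_trans ew; rewrite divr_gt0.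
apply: (@le_trans _ _ (eps / n%:R * (par_J n Delta eps)%:R)); last first.
  by apply: ler_pM => //; rewrite divr_ge0 // ltW.
have -> : (par_J n Delta eps)%:R = (par_Q Delta eps)%:R * n%:R * (par_q eps)%:R :> R.
  by rewrite /par_J; move: (par_Q _ _) (par_q _) => ? ?; rewrite !natrM.
have -> : eps / n%:R * ((par_Q Delta eps)%:R * n%:R * (par_q eps)%:R) =
   (par_Q Delta eps)%:R * (eps * (par_q eps)%:R) by field; rewrite gt_eqF.
by rewrite ler_peMr.
Qed.

(** One summand of [par_act] absorbs [T0 / theta = Q] through [Q <= 2 ^ Q]; the other brings the
    threshold below [wm]. *)
Lemma par_idle Delta eps wm j : 0 < eps -> 0 < wm -> (par_act Delta eps wm <= j)%N ->
  thr (par_T0 Delta eps) j / par_theta Delta eps < wm.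
Proof.
move=> e0 w0 aj; rewrite /thr mulrAC -par_QE // ltr_pdivrMr ?exprn_gt0 //.
rewrite -ltr_pdivrMl //.
set l := (Num.truncn (log2 wm^-1)).+1.
have hl : wm^-1 < 2 ^+ l.
  rewrite ltNge; apply/negP => /(log2_le (exprn_gt0 l (ltr0n R 2))).
  by rewrite log2X leNgt truncnS_gt.
have hQ : (par_Q Delta eps)%:R <= 2 ^+ par_Q Delta eps :> R.
  by rewrite -natrX ler_nat ltnW // ltn_expl.
apply: (@lt_le_trans _ _ (2 ^+ l * 2 ^+ par_Q Delta eps)).
  apply: (@lt_le_trans _ _ (2 ^+ l * (par_Q Delta eps)%:R)); last first.
    by rewrite ler_pM2l // exprn_gt0.
  by rewrite ltr_pM2r // ltr0n 2!muln_gt0 par_q_gt0 expn_gt0 par_b_gt0.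
by rewrite -exprD addnC ler_weXn2l // ler1n.
Qed.

Lemma par_const_bound Delta eps : (1 < Delta)%N ->
  (1 + (par_rho eps).*2 + (par_rho eps).*2 *
     (par_K Delta eps * (par_C Delta eps * (par_Q Delta eps + 2)))
   <= Delta ^ (2 * (49 + 17 * 2 ^ (k + 5)) * par_q eps))%N.
Proof.
move=> D2; set c := (2 ^ (k + 5))%N; set q := par_q eps; set y := par_y Delta.
have q0 : (0 < q)%N by [].
have y0 : (0 < y)%N by [].
have bD : (2 ^ y <= Delta ^ 2)%N.
  rewrite /y /par_y expnS -mulnn leq_mul // trunc_logP //; lia.
have q2 : (q <= 2 ^ q)%N by rewrite ltnW // ltn_expl.
have rE : (par_rho eps).*2 = (16 * q)%N by rewrite /par_rho -/q; lia.
rewrite rE.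
set p := (16 * q * y)%N.
have bE : (par_b Delta ^ (16 * q) = 2 ^ p)%N.
  by rewrite /par_b -expnM -/y /p; congr (2 ^ _)%N; lia.
have KE : (par_K Delta eps <= 2 ^ (4 + p + q))%N.
  rewrite /par_K rE bE -/q !expnD -[(2 ^ 4)%N]/16%N; nia.
have CE : par_C Delta eps = (2 ^ (c * p.+1))%N.
  by rewrite /par_C /par_z rE -/y -/c /p; congr (2 ^ (_ * _.+1))%N; lia.
have QE : (par_Q Delta eps + 2 <= 2 ^ (5 + q + p))%N.
  rewrite /par_Q rE bE -/q !expnD -[(2 ^ 5)%N]/32%N.
  have : (0 < 2 ^ p)%N by rewrite expn_gt0.
  have : (0 < 2 ^ q)%N by rewrite expn_gt0.
  nia.
have E1 : (16 * q <= 2 ^ (4 + q))%N by rewrite expnD leq_mul.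
set e := ((4 + q) + ((4 + p + q) + (c * p.+1 + (5 + q + p))))%N.
have P : (16 * q * (par_K Delta eps * (par_C Delta eps * (par_Q Delta eps + 2)))
    <= 2 ^ e)%N.
  rewrite /e (expnD _ (4 + q)) (expnD _ (4 + p + q)) (expnD _ (c * p.+1)) CE.
  exact: leq_mul E1 (leq_mul KE (leq_mul (leqnn _) QE)).
have P1 : (1 + 16 * q <= 2 ^ e)%N.
  apply: (@leq_trans (2 ^ (5 + q))).
    rewrite expnD -[(2 ^ 5)%N]/32%N; move: (2 ^ q)%N q2 q0 => m; lia.
  by rewrite leq_exp2l // /e; lia.
apply: (@leq_trans (2 ^ e.+1)); first by rewrite expnS; lia.
(* The exponent [e.+1] is [14 + 3q + 2p + c(p + 1)] with [p = 16qy], and [1] and [q] are at most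
   [qy]; so [49 = 14 + 3 + 32] and [17 = 16 + 1]. *)
apply: (@leq_trans (2 ^ (y * ((49 + 17 * c) * q)))).
  rewrite leq_exp2l // /e /p.
  have h1 : (1 <= q * y)%N by rewrite muln_gt0 q0.
  have h2 : (q <= q * y)%N by rewrite leq_pmulr.
  have h3 : (c <= c * (q * y))%N by rewrite leq_pmulr.
  have -> : (y * ((49 + 17 * c) * q) = 49 * (q * y) + 17 * (c * (q * y)))%N by ring.
  have -> : (c * (16 * q * y).+1 = 16 * (c * (q * y)) + c)%N by ring.
  rewrite -mulnA; lia.
rewrite expnM -mulnA (expnM Delta) leq_exp2r //; lia.
Qed.

Lemma affine_scale (r K C Q l : nat) (L : R) : 1 <= L -> l%:R <= 2 * L ->
  (1 + r + r * (K * (C * (Q + l))))%:R <= (1 + r + r * (K * (C * (Q + 2))))%:R * L.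
Proof.
move=> L1 l1; rewrite !natrD !natrM !natrD.
have : 0 <= r%:R * (K%:R * C%:R) * (2 * L - l%:R) :> R.
  by rewrite !mulr_ge0 // subr_ge0.
have : 0 <= r%:R * (K%:R * C%:R) * Q%:R * (L - 1) :> R.
  by rewrite !mulr_ge0 // subr_ge0.
have : 0 <= (1 + r%:R) * (L - 1) :> R.
  by rewrite mulr_ge0 ?subr_ge0 // addr_ge0.
lra.
Qed.

Lemma par_rounds_bound n Delta eps wm : 0 < eps < 1 -> (1 < n)%N -> 0 < wm ->
  (par_rounds n Delta eps wm)%:R <=
  32 * (eps ^- 2 * lg eps^-1 * (logstar R n)%:R) +
  Delta%:R `^ ((4 * (49 + 17 * 2 ^ (k + 5)))%:R / eps) * lg wm^-1.
Proof.
move=> e01 n1 w0; have [e0 e1] := andP e01.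
have lg1 x : 1 <= lg x :> R by rewrite /lg le_max lexx.
have lg0 x : 0 <= lg x :> R by apply: le_trans (lg1 x).
have i1 : 1 <= eps^-1 by rewrite invf_ge1 // ltW.
have t1 : 0 <= 32 * (eps ^- 2 * lg eps^-1 * (logstar R n)%:R).
  by rewrite !mulr_ge0 // ?lg0 // invr_ge0 exprn_ge0 // ltW.
have t2 : 0 <= Delta%:R `^ ((4 * (49 + 17 * 2 ^ (k + 5)))%:R / eps) * lg wm^-1.
  by rewrite mulr_ge0 // powR_ge0.
rewrite /par_rounds; case: leqP => D1; first by rewrite addr_ge0.
set rho2 := (par_rho eps).*2; set K := par_K Delta eps; set C := par_C Delta eps.
set Q := par_Q Delta eps; set l := (Num.truncn (log2 wm^-1)).+1.
have -> : (par_radius n Delta eps wm).+1 =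
  ((logstar R n).-1 * rho2 + (1 + rho2 + rho2 * (K * (C * (Q + l)))))%N.
  by rewrite /par_radius /par_act -/rho2 -/K -/C -/Q -/l; ring.
rewrite natrD; apply: lerD.
  rewrite natrM.
  have h1 : (logstar R n).-1%:R <= (logstar R n)%:R :> R by rewrite ler_nat leq_pred.
  have h2 : rho2%:R <= 32 * eps^-1.
    have -> : rho2 = (16 * par_q eps)%N by rewrite /rho2 /par_rho; lia.
    by rewrite natrM; have := par_q_le e01; lra.
  (* The colouring takes [O(1/eps)] rounds per reduction, within the first term. *)
  have h3 : eps^-1 <= eps ^- 2 * lg eps^-1.
    rewrite -exprVn expr2 -mulrA ler_peMr ?mulr_ege1 //; exact: le_trans i1.
  apply: le_trans (ler_pM (ler0n _ _) (ler0n _ _) h1 h2) _.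
  by rewrite mulrCA ler_pM2l // mulrC ler_wpM2r.
have l1 : l%:R <= 2 * lg wm^-1.
  have [h|h] := leP 0 (log2 wm^-1).
    have : (Num.truncn (log2 wm^-1))%:R <= log2 wm^-1 by rewrite truncn_le.
    have : log2 wm^-1 <= lg wm^-1 by rewrite /lg le_max lexx orbT.
    by have := lg1 wm^-1; rewrite /l -natr1; lra.
  have -> : l = 1%N.
    by rewrite /l; congr _.+1; apply/truncn0Pn; rewrite -ltNge; lra.
  by have := lg1 wm^-1; lra.
set A := (1 + rho2 + rho2 * (K * (C * (Q + 2))))%N.
apply: (@le_trans _ _ (A%:R * lg wm^-1)).
  exact: affine_scale.
apply: ler_wpM2r; first exact: lg0.
have AD := par_const_bound eps D1; rewrite -/rho2 -/K -/C -/Q -/A in AD.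
apply: (@le_trans _ _ (Delta%:R `^ (2 * (49 + 17 * 2 ^ (k + 5)) * par_q eps)%:R)).
  by rewrite powR_mulrn // -natrX ler_nat.
apply: ler_powR; first by rewrite ler1n; lia.
rewrite natrM.
have -> : (4 * (49 + 17 * 2 ^ (k + 5)))%:R / eps =
  (2 * (49 + 17 * 2 ^ (k + 5)))%:R * (2 * eps^-1) :> R.
  by rewrite !natrM; ring.
by rewrite ler_wpM2l // par_q_le.
Qed.

End Schedule.

(** * Networks and views *)

Section IdMatrix.
Variables (R : realType) (k : nat).

Definition vertex_of (G : wgraph R) (N : network G) (i : nat) : option G :=
  [pick u | ident N u == i].

(** Indices are identifiers rather than vertices, so networks with different vertex types but equal
    [n] yield matrices of the same type. *)
Definition wmatrix (n : nat) (eps : R) (G : wgraph R) (N : network G)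
    (i j : 'I_(n ^ k).+1) : R :=
  if vertex_of N i is Some u then
    if vertex_of N j is Some v then
      if ([set u; v] \in edges G) && (eps / n%:R <= wt [set u; v])
      then wt [set u; v] else 0
    else 0
  else 0.

Definition mwm (n Delta : nat) (eps : R)
    (W : 'I_(n ^ k).+1 -> 'I_(n ^ k).+1 -> R) : 'I_(n ^ k).+1 -> 'I_(n ^ k).+1 :=
  iter (par_K Delta eps)
    (run W (4 * par_q eps) (par_C k Delta eps)
       (colour (@nat_of_ord _) (par_z Delta eps) (par_rho eps).*2
          (k * (trunc_log 2 n).+1).+1 (logstar R n).-1 W)
       (par_T0 Delta eps) (par_theta Delta eps)
       (par_J n Delta eps * par_C k Delta eps)) id.

Definition port_output (n Delta : nat) (eps : R) (G : wgraph R) (N : network G)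
    (v : G) : pred nat := fun p =>
  (Delta <= 1)%N ||
  (nat_of_ord (mwm Delta eps (wmatrix eps N) (inord (ident N v) : 'I_(n ^ k).+1))
     == nth 0%N [seq ident N u | u <- ports N v] p).

Section OneNetwork.
Variables (G : wgraph R) (N : network G) (n : nat) (eps : R).
Hypothesis idn : forall v, (ident N v <= n ^ k)%N.
Let W := @wmatrix n eps G N.

Lemma vertex_of_ident v : vertex_of N (ident N v) = Some v.
Proof.
rewrite /vertex_of; case: pickP => [u /eqP/ident_inj->//|/(_ v)].
by rewrite eqxx.
Qed.

Lemma vertex_ofP i u : vertex_of N i = Some u -> ident N u = i.
Proof. by rewrite /vertex_of; case: pickP => // x /eqP <- [<-]. Qed.

Definition idx v : 'I_(n ^ k).+1 := inord (ident N v).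

Lemma idxK v : idx v = ident N v :> nat.
Proof. by rewrite inordK // ltnS. Qed.

Lemma idx_inj : injective idx.
Proof. by move=> u v /(congr1 (@nat_of_ord _)); rewrite !idxK => /ident_inj. Qed.

Lemma vertex_of_idx v : vertex_of N (idx v) = Some v.
Proof. by rewrite idxK vertex_of_ident. Qed.

Lemma wmatrix_idx u v : W (idx u) (idx v) =
  if ([set u; v] \in edges G) && (eps / n%:R <= wt [set u; v])
  then wt [set u; v] else 0.
Proof. by rewrite /W /wmatrix !vertex_of_idx. Qed.

Lemma wmatrix_neq0 i j : W i j != 0 -> exists u v,
  [/\ i = idx u, j = idx v, [set u; v] \in edges G, eps / n%:R <= wt [set u; v]
    & W i j = wt [set u; v]].
Proof.
rewrite /W /wmatrix; case Ei: vertex_of => [u|]; last by rewrite eqxx.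
case Ej: vertex_of => [v|]; last by rewrite eqxx.
case: ifP => [/andP[e h] _|]; last by rewrite eqxx.
exists u, v; split=> //; apply: val_inj; rewrite /= idxK.
  by rewrite (vertex_ofP Ei).
by rewrite (vertex_ofP Ej).
Qed.

Definition row_of (ids : seq nat) (ws : seq R) (j : nat) : R :=
  if (j \in ids) && (eps / n%:R <= nth 0 ws (index j ids))
  then nth 0 ws (index j ids) else 0.

Lemma wmatrix_row v j : W (idx v) j =
  row_of [seq ident N u | u <- ports N v] [seq wt [set v; u] | u <- ports N v] j.
Proof.
rewrite /W /wmatrix vertex_of_idx /row_of; case Ej: vertex_of => [u|]; last first.
  case: ifP => // /andP[/mapP[u _ ju] _].
  by rewrite ju vertex_of_ident in Ej.
rewrite -(vertex_ofP Ej) mem_map; last exact: ident_inj.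
rewrite index_map; last exact: ident_inj.
rewrite ports_nbrs inE; case e: (_ \in _) => //=.
have uin : u \in ports N v by rewrite ports_nbrs inE.
by rewrite (nth_map u) ?index_mem // nth_index.
Qed.

End OneNetwork.

(** States of the full-information protocol, in which every message is the whole history of its
    sender. *)
Inductive view := View0 of local_input R | ViewS of view & seq view.

Fixpoint view_at (G : wgraph R) (N : network G) (eps : R) (t : nat) (v : G) : view :=
  if t is t'.+1 then
    ViewS (view_at N eps t' v) [seq view_at N eps t' u | u <- ports N v]
  else View0 (input_at N eps v).

Fixpoint view_depth w := if w is ViewS w' _ then (view_depth w').+1 else 0%N.
Fixpoint view_root w := match w with ViewS w' _ => view_root w' | View0 i => i end.

Lemma view_depthE G (N : network G) eps t v : view_depth (view_at N eps t v) = t.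
Proof. by elim: t => //= t ->. Qed.

Lemma view_rootE G (N : network G) eps t v :
  view_root (view_at N eps t v) = input_at N eps v.
Proof. by elim: t => //= t ->. Qed.

(** One round reveals the identifiers behind the ports, and with the weights in the input this
    determines a row of the matrix. Following the ports, each further round adds the rows one step
    further away. *)
Lemma view_agree n eps G (N : network G) G' (N' : network G') :
  (forall v, (ident N v <= n ^ k)%N) -> (forall v, (ident N' v <= n ^ k)%N) ->
  forall t v v', view_at N eps t.+1 v = view_at N' eps t.+1 v' ->
  agree (@wmatrix n eps G N) (@wmatrix n eps G' N') t (idx N n v).
Proof.
move=> idn idn'.
have ids t v v' : view_at N eps t.+1 v = view_at N' eps t.+1 v' ->
    [/\ ident N v = ident N' v',
        [seq ident N u | u <- ports N v] = [seq ident N' u | u <- ports N' v'],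
        [seq wt [set v; u] | u <- ports N v] = [seq wt [set v'; u] | u <- ports N' v']
      & [seq view_at N eps t u | u <- ports N v]
          = [seq view_at N' eps t u | u <- ports N' v']].
  move=> [E0 E1]; have E2 := congr1 view_root E0; rewrite !view_rootE in E2.
  have idE : ident N v = ident N' v' := congr1 (@in_id _) E2.
  split=> //; last exact (congr1 (@in_wts _) E2).
  have := congr1 (map (fun w => in_id (view_root w))) E1; rewrite -!map_comp.
  by under eq_map => u do rewrite /= view_rootE; under [RHS]eq_map => u do rewrite /= view_rootE.
have rows t v v' : view_at N eps t.+1 v = view_at N' eps t.+1 v' ->
    @wmatrix n eps G N (idx N n v) =1 @wmatrix n eps G' N' (idx N n v).
  move=> /ids[e1 e2 e3 _] j.
  by rewrite {2}/idx e1 -/(idx N' n v') !wmatrix_row // e2 e3.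
elim=> [|t IH] v v' E.
  by move=> x; rewrite /= inE => /eqP->; apply: rows E.
move=> x /ballSP[->|[l vl xl]]; first exact: rows E.
have [u [u' [/idx_inj vu lu' e _ _]]] := wmatrix_neq0 idn (lt0r_neq0 vl).
have {u vu} e : [set v; u'] \in edges G by rewrite (vu idn).
have u'v : u' \in ports N v by rewrite ports_nbrs inE.
have [_ _ _ e4] := ids _ _ _ E.
have /(nthP u')[p pl up] := u'v.
have pl' : (p < size (ports N' v'))%N.
  by have := congr1 size e4; rewrite !size_map => <-.
have := congr1 (fun s => nth (view_at N eps t.+1 v) s p) e4.
rewrite (nth_map u') // (nth_map v') // up => /IH; apply.
by rewrite lu' in xl.
Qed.

Lemma mwm_local n Delta eps wm : 0 < eps -> 0 < wm ->
  local wm (par_radius k n Delta eps wm) (@mwm n Delta eps).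
Proof.
move=> e0 w0; rewrite /par_radius.
apply: local_rounds.
- by move=> j; apply: par_idle.
- by rewrite expn_gt0.
- exact: leq_addl.
- by apply: local_le (leq_addr _ _) _; apply: colour_local.
Qed.

Definition determines (w : view) (o : pred nat) : Prop :=
  forall eps G (N : network G) v t, (forall u, (ident N u <= #|G| ^ k)%N) ->
  view_at N eps t v = w -> port_output #|G| (max_degree G) eps N v = o.

(** The choice is classical; the model puts no limit on local computation. *)
Definition view_output (w : view) : option (pred nat) :=
  if pselect (exists o, determines w o) is left e then Some (projT1 (cid e)) else None.

Definition mwm_algorithm : algorithm R :=
  {| alg_state := view; alg_msg := view; alg_init := View0;
     alg_send := fun w _ => w; alg_recv := ViewS; alg_out := view_output |}.

Lemma state_view G (N : network G) eps t v :
  state_at mwm_algorithm N eps t v = view_at N eps t v.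
Proof.
elim: t v => //= t IH v; congr ViewS; first exact: IH.
by apply: eq_map => u; apply: IH.
Qed.

(** Early outputs are harmless: whatever is determined by an earlier view of this network holds for
    this network too, so it is the same output. *)
Lemma output_mwm G (N : network G) eps r v :
  (forall u, (ident N u <= #|G| ^ k)%N) ->
  determines (view_at N eps r v) (port_output #|G| (max_degree G) eps N v) ->
  output_at mwm_algorithm N eps r v = Some (port_output #|G| (max_degree G) eps N v).
Proof.
move=> idn det; set o := port_output _ _ _ _ _ in det *.
have A t o' : view_output (view_at N eps t v) = Some o' -> o' = o.
  rewrite /view_output; case: pselect => // e [<-].
  by case: cid => o'' /= /(_ eps G N v t idn erefl).
have B t o' : output_at mwm_algorithm N eps t v = Some o' -> o' = o.
  elim: t o' => [|t IH] o' /=; first exact: (A 0%N).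
  case E: output_at => [o''|]; first by move=> [<-]; apply: IH.
  by have := state_view N eps t.+1 v => /= ->; apply: (A t.+1).
have out : view_output (view_at N eps r v) = Some o.
  rewrite /view_output; case: pselect => [e|[]]; last by exists o.
  by congr Some; case: cid => o'' /= /(_ eps G N v r idn erefl).
case: r det out => [|r] det out //=.
case E: output_at => [o'|]; first by rewrite (B _ _ E).
by have := state_view N eps r.+1 v => /= ->.
Qed.

Lemma mwm_determined G (N : network G) eps wm v :
  0 < eps -> 0 < wm -> (forall u, (ident N u <= #|G| ^ k)%N) ->
  (forall i j, 0 < @wmatrix #|G| eps G N i j -> wm <= wmatrix eps N i j) ->
  determines (view_at N eps (par_rounds k #|G| (max_degree G) eps wm) v)
    (port_output #|G| (max_degree G) eps N v).
Proof.
move=> e0 w0 idn Wm eps' G' N' v' t' idn' E.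
have := congr1 view_depth E; rewrite !view_depthE => tE; subst t'.
have := congr1 view_root E; rewrite !view_rootE => iE.
have eE : eps' = eps := congr1 (@in_eps _) iE; subst eps'.
have nE : #|G'| = #|G| := congr1 (@in_n _) iE.
have dE : max_degree G' = max_degree G := congr1 (@in_maxdeg _) iE.
have idE : ident N' v' = ident N v := congr1 (@in_id _) iE.
rewrite dE nE; rewrite nE in idn'.
apply/funext => p; rewrite /port_output.
move: E; rewrite /par_rounds; case: leqP => //= _ E.
have ag := view_agree idn idn' (esym E).
rewrite idE -(mwm_local e0 w0 Wm ag) -/(idx N _ v).
congr (_ == nth _ _ _).
have [_ E1] := E.
have := congr1 (map (fun w => in_id (view_root w))) E1; rewrite -!map_comp.
by under eq_map => u do rewrite /= view_rootE; under [RHS]eq_map => u do rewrite /= view_rootE.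
Qed.

End IdMatrix.

(** * Correctness *)

Section EdgeSets.
Variables (R : realType) (G : wgraph R).
Implicit Types (M : {set {set G}}) (u v x : G).

Lemma edge_pair e x : e \in edges G -> x \in e -> exists y, e = [set x; y].
Proof.
move=> /edges_card2/eqP/cards2P[a [b [ab ->]]].
rewrite !inE => /orP[]/eqP->; first by exists b.
by exists a; rewrite setUC.
Qed.

Lemma edge_neq u v : [set u; v] \in edges G -> u != v.
Proof. by move/edges_card2; rewrite cards2; case: eqP. Qed.

Lemma matchingP M : reflect (M \subset edges G /\
    forall x y y', [set x; y] \in M -> [set x; y'] \in M -> y = y') (matching M).
Proof.
apply: (iffP andP) => -[sM h]; split=> //.
  move=> x y y' xy xy'; have : [set x; y] = [set x; y'].
    apply: contraTeq (set21 x y) => ne; have /trivIsetP/(_ _ _ xy xy' ne) := h.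
    by move/disjointFl=> -> //; rewrite set21.
  move/setP/(_ y); rewrite !inE eqxx orbT => /esym/orP[|/eqP//].
  by have /edge_neq := subsetP sM _ xy; rewrite eq_sym => /negPf->.
apply/trivIsetP => e e' eM e'M; apply: contraR => /pred0Pn[x /andP[/= xe xe']].
have [y Ey] := edge_pair (subsetP sM _ eM) xe.
have [y' Ey'] := edge_pair (subsetP sM _ e'M) xe'.
by subst e e'; rewrite (h _ _ _ eM e'M).
Qed.

Lemma weight_double M : M \subset edges G ->
  2 * weight M = \sum_v \sum_(e in M | v \in e) wt e.
Proof.
move=> sM; rewrite (exchange_big_dep (mem M)) => [|v e _ /andP[]//] /=.
rewrite /weight mulr_sumr; apply: eq_bigr => e eM.
transitivity (\sum_(v in e) wt e); last by apply: eq_bigl => v; rewrite eM.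
by rewrite sumr_const (edges_card2 (subsetP sM _ eM)) mulr_natl.
Qed.

Lemma weight_sub M M' : M \subset M' -> M' \subset edges G -> weight M <= weight M'.
Proof.
move=> sM sM'; rewrite /weight [leRHS](big_setID M) /= (setIidPr sM) lerDl.
by apply: sumr_ge0 => e; rewrite inE => /andP[_ /(subsetP sM')/wt_gt0/ltW].
Qed.

Lemma normalized_le1 : normalized G -> forall e, e \in edges G -> wt e <= 1.
Proof. by move=> <- e eG; rewrite (bigD1 e) //= le_max lexx. Qed.

Lemma normalized_edge : normalized G -> exists2 e, e \in edges G & wt e = 1.
Proof.
move=> nG; have [/existsP[e /andP[eG /eqP]]|] :=
  boolP [exists e, (e \in edges G) && (wt e == 1)]; first by exists e.
rewrite negb_exists => /forallP h.
suff : \big[Num.max/0]_(e in edges G) wt e < 1 by rewrite nG ltxx.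
elim/big_ind: _ => // [x y x1 y1|e eG]; first by rewrite gt_max x1.
rewrite lt_neqAle normalized_le1 // andbT.
by have := h e; rewrite eG.
Qed.

Lemma normalized_card : normalized G -> (1 < #|G|)%N.
Proof.
case/normalized_edge => e /edges_card2 e2 _.
by rewrite -e2 max_card.
Qed.

(** The edge of weight 1 alone is a matching. This converts the additive loss from light edges into
    a relative one. *)
Lemma max_weight_ge1 M : normalized G -> max_weight_matching M -> 1 <= weight M.
Proof.
move=> /normalized_edge[e eG e1] [_ /(_ [set e])].
have -> : weight [set e] = 1 by rewrite /weight big_set1.
apply; rewrite /matching sub1set eG /=; apply/trivIsetP => a b.
by rewrite !inE => /eqP-> /eqP->; rewrite eqxx.
Qed.

Lemma wmin_gt0 eps : 0 < wmin G eps.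
Proof.
rewrite /wmin; elim/big_ind: _ => // [x y x0 y0|e /andP[eG _]].
  by rewrite lt_min x0.
exact: wt_gt0.
Qed.

Lemma wmin_le eps e : e \in edges G -> eps / #|G|%:R <= wt e -> wmin G eps <= wt e.
Proof. by move=> eG h; rewrite /wmin (bigD1 e) /= ?eG // ge_min lexx. Qed.

Lemma degree_le v : (#|nbrs v| <= max_degree G)%N.
Proof. exact: leq_bigmax. Qed.

End EdgeSets.

Section Correctness.
Variables (R : realType) (k : nat) (G : wgraph R) (N : network G) (eps : R).
Hypotheses (nG : normalized G) (eps01 : 0 < eps < 1).
Hypothesis idn : forall v, (ident N v <= #|G| ^ k)%N.

Local Notation n := #|G|.
Local Notation Delta := (max_degree G).
Local Notation W := (@wmatrix R k n eps G N).
Local Notation f := (@idx R k G N n).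
Local Notation mu := (@mwm R k n Delta eps W).

Let e0 : 0 < eps. Proof. by case/andP: eps01. Qed.
Let n1 : (1 < n)%N. Proof. exact: normalized_card. Qed.

Lemma wmatrix_sym : wsym W.
Proof.
move=> i j; rewrite /wmatrix; case: (vertex_of N i) => [u|]; last by case: vertex_of.
by case: vertex_of => // v; rewrite setUC.
Qed.

Lemma wmatrix_ge0 i j : 0 <= W i j.
Proof.
have [->//|/(wmatrix_neq0 idn)[u [v [_ _ uv _ ->]]]] := eqVneq (W i j) 0.
exact: ltW (wt_gt0 uv).
Qed.

Lemma wmatrix_le1 i j : W i j <= 1.
Proof.
have [->//|/(wmatrix_neq0 idn)[u [v [_ _ uv _ ->]]]] := eqVneq (W i j) 0.
exact: normalized_le1.
Qed.

Lemma wmatrix_diag i : W i i = 0.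
Proof.
apply/eqP; apply: contraT => /(wmatrix_neq0 idn)[u [v [-> /(idx_inj idn)->]]].
by move/edge_neq; rewrite eqxx.
Qed.

Lemma wmatrix_wmin i j : 0 < W i j -> wmin G eps <= W i j.
Proof.
move=> /lt0r_neq0/(wmatrix_neq0 idn)[u [v [_ _ uv h ->]]].
exact: wmin_le.
Qed.

Lemma wmatrix_deg i : (#|nb W i| < par_b Delta)%N.
Proof.
apply: (@leq_ltn_trans Delta); last by rewrite /par_b trunc_log_ltn.
case E: (vertex_of N i) => [u|]; last first.
  rewrite (_ : nb W i = set0) ?cards0 //; apply/setP=> j; rewrite !inE.
  by rewrite /wmatrix E ltxx.
apply: leq_trans (degree_le u); rewrite -(card_imset _ (idx_inj idn)).
apply: subset_leq_card; apply/subsetP => j; rewrite inE.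
move=> /lt0r_neq0/(wmatrix_neq0 idn)[u' [v [iu -> uv _ _]]].
have -> : u = u' by move: E; rewrite iu vertex_of_idx // => -[].
by apply: imset_f; rewrite inE.
Qed.

Local Notation col := (colour (@nat_of_ord _) (par_z Delta eps) (par_rho eps).*2
          (k * (trunc_log 2 n).+1).+1 (logstar R n).-1 W).

Lemma id_bound (i : 'I_(n ^ k).+1) : (i < 2 ^ (k * (trunc_log 2 n).+1).+1)%N.
Proof.
apply: leq_trans (ltn_ord i) _.
have : (n ^ k <= 2 ^ (k * (trunc_log 2 n).+1))%N.
  rewrite mulnC expnM; case: (posnP k) => [->//|k0].
  by rewrite leq_exp2r // ltnW // trunc_log_ltn.
have : (0 < 2 ^ (k * (trunc_log 2 n).+1))%N by rewrite expn_gt0.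
by rewrite expnS; lia.
Qed.

Lemma col_proper : proper_col W (par_rho eps).*2 col.
Proof.
apply: colour_proper; [exact: val_inj|exact: id_bound|exact: wmatrix_sym|].
move=> i; rewrite /par_z expnM; apply: card_ball; exact: wmatrix_deg.
Qed.

Lemma col_bound i : (col i < par_C k Delta eps)%N.
Proof.
apply: leq_trans (colour_lt _ _ id_bound _ _ _) _.
by rewrite leq_exp2l // exps_bound.
Qed.

Lemma mu_low u v : 0 < W u v ->
  thr (par_T0 Delta eps) (par_J n Delta eps) <= par_theta Delta eps * W u v.
Proof.
move=> uv; apply: par_low => //; first exact: ltnW.
by have [x [y [_ _ _ h ->]]] := wmatrix_neq0 idn (lt0r_neq0 uv).
Qed.

Lemma mu_mtch : mtch W mu.
Proof. by apply: rounds_mtch; [exact: wmatrix_sym|exact: col_proper]. Qed.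

Lemma mu_approx ms : mtch W ms ->
  ((2 * par_q eps)%N%:R - 1) * wt2 W ms <= (2 * par_q eps)%N%:R * wt2 W mu.
Proof.
apply: (rounds_approx wmatrix_sym wmatrix_diag wmatrix_ge0 wmatrix_le1 wmatrix_deg
  col_proper col_bound) => //.
- exact: par_b_gt0.
- exact: mu_low.
Qed.

Definition out_edges : {set {set G}} :=
  [set e in edges G | [exists v, exists u, (e == [set v; u]) && (mu (f v) == f u)]].

Lemma mem_out v u : ([set v; u] \in out_edges) =
  ([set v; u] \in edges G) && (mu (f v) == f u).
Proof.
rewrite inE; case uv: (_ \in _) => //=.
apply/existsP/idP => [[v' /existsP[u' /andP[/eqP E m]]]|m]; last first.
  by exists v; apply/existsP; exists u; rewrite eqxx.
have nvu := edge_neq uv.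
have : v \in [set v'; u'] by rewrite -E set21.
have : u \in [set v'; u'] by rewrite -E set22.
rewrite !inE => /orP[]/eqP eu /orP[]/eqP ev; subst; rewrite ?eqxx // in nvu *.
by move/eqP: m => <-; rewrite (proj1 mu_mtch).
Qed.

Lemma out_matching : matching out_edges.
Proof.
apply/matchingP; split; first by apply/subsetP => e; rewrite inE => /andP[].
move=> x y y'; rewrite !mem_out => /andP[_ /eqP->] /andP[_ /eqP].
exact: idx_inj.
Qed.

Lemma sum_idx (F : 'I_(n ^ k).+1 -> R) :
  (forall i : 'I_(n ^ k).+1, vertex_of N i = None -> F i = 0) -> \sum_i F i = \sum_v F (f v).
Proof.
move=> F0; rewrite (bigID (mem (f @: [set: G]))) /= [X in _ + X]big1 ?addr0.
  rewrite big_imset /=; last by move=> x y _ _; apply: idx_inj.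
  by apply: eq_bigl => v; rewrite inE.
move=> i iN; apply: F0; case E: vertex_of => [u|//]; case/negP: iN.
apply/imsetP; exists u => //; apply: val_inj.
by rewrite /= idxK // (vertex_ofP E).
Qed.

Lemma wt2_idx g : wt2 W g = \sum_v W (f v) (g (f v)).
Proof. by apply: sum_idx => i E; rewrite /wmatrix E. Qed.

Lemma out_weight : wt2 W mu <= 2 * weight out_edges.
Proof.
have /matchingP[sM _] := out_matching.
rewrite weight_double // wt2_idx; apply: ler_sum => v _.
have [->|] := eqVneq (W (f v) (mu (f v))) 0.
  by apply: sumr_ge0 => e /andP[/(subsetP sM)/wt_gt0/ltW].
move=> /(wmatrix_neq0 idn)[v' [u [/(idx_inj idn) <- m vu _ ->]]].
rewrite (bigD1 [set v; u]) /=; last by rewrite mem_out vu set21 m eqxx.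
by rewrite lerDl; apply: sumr_ge0 => e /andP[/andP[/(subsetP sM)/wt_gt0/ltW]].
Qed.

(** * Comparison with an arbitrary matching *)

Section Compare.
Variable M : {set {set G}}.
Hypothesis mM : matching M.

Let heavy v u := ([set v; u] \in M) && (eps / n%:R <= wt [set v; u]).

Definition partner (i : 'I_(n ^ k).+1) : 'I_(n ^ k).+1 :=
  if vertex_of N i is Some v then
    if [pick u | heavy v u] is Some u then f u else i
  else i.

Lemma heavy_sym u v : heavy u v = heavy v u.
Proof. by rewrite /heavy setUC. Qed.

Lemma heavy_uniq v u u' : heavy v u -> heavy v u' -> u = u'.
Proof.
have /matchingP[_ h] := mM.
by move=> /andP[h1 _] /andP[h2 _]; apply: h h1 h2.
Qed.

Lemma partner_heavy v u : heavy v u -> partner (f v) = f u.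
Proof.
move=> vu; rewrite /partner vertex_of_idx //; case: pickP => [u' vu'|/(_ u)].
  by rewrite (heavy_uniq vu vu').
by rewrite vu.
Qed.

Lemma partner_mtch : mtch W partner.
Proof.
have /matchingP[sM _] := mM.
have H i : partner i = i \/ exists v u, [/\ i = f v, partner i = f u & heavy v u].
  rewrite /partner; case E: vertex_of => [v|]; last by left.
  case: pickP => [u vu|_]; last by left.
  by right; exists v, u; split=> //; apply: val_inj; rewrite /= idxK // (vertex_ofP E).
split=> i; have [e|[v [u [iv -> vu]]]] := H i.
- by rewrite !e.
- by rewrite iv; apply: partner_heavy; rewrite heavy_sym.
- by left.
- right; rewrite iv wmatrix_idx //; case/andP: vu => vu h.
  by rewrite (subsetP sM _ vu) h; apply: wt_gt0 (subsetP sM _ vu).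
Qed.

(** Each vertex loses at most [eps / n] with its light edge; the total [eps] refers to the doubled
    weight. *)
Lemma partner_weight : 2 * weight M - eps <= wt2 W partner.
Proof.
have /matchingP[sM uM] := mM.
have n0 : 0 < n%:R :> R by rewrite ltr0n ltnW.
rewrite [X in _ - X](_ : eps = \sum_(v : G) eps / n%:R); last first.
  by rewrite sumr_const -[RHS]mulr_natr divfK // gt_eqF.
rewrite weight_double // wt2_idx -sumrB; apply: ler_sum => v _.
rewrite lerBlDr.
have [/existsP[u vu]|] := boolP [exists u, [set v; u] \in M]; last first.
  rewrite negb_exists => /forallP h; rewrite big1 ?addr_ge0 ?wmatrix_ge0 //.
    by rewrite divr_ge0 // ltW.
  move=> e /andP[eM ve]; have [y ey] := edge_pair (subsetP sM _ eM) ve.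
  by have := h y; rewrite -ey eM.
rewrite (big_pred1 [set v; u]) => [|e]; last first.
  apply/andP/eqP => [[eM ve]|->]; last by rewrite vu set21.
  have [y ey] := edge_pair (subsetP sM _ eM) ve.
  by rewrite ey (uM v y u) -?ey.
have [h|h] := leP (eps / n%:R) (wt [set v; u]).
  rewrite (@partner_heavy v u); last by rewrite /heavy vu h.
  by rewrite wmatrix_idx // (subsetP sM _ vu) h lerDl divr_ge0 // ltW.
by have := wmatrix_ge0 (f v) (partner (f v)); lra.
Qed.

End Compare.

(** The result weighs at least [(1 - 1/(2q)) (w - eps/2)]. Since [1/q <= eps] and [w >= 1], each of
    the two losses is at most [eps * w / 2]. *)
Lemma out_approx : approx_mwm eps out_edges.
Proof.
split=> [|M maxM]; first exact: out_matching.
have w1 := max_weight_ge1 nG maxM; have [mM _] := maxM.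
have h1 := mu_approx (partner_mtch mM); have h2 := partner_weight mM.
have h3 := out_weight.
have q1 : 1 <= eps * (par_q eps)%:R.
  by rewrite -ler_pdivrMl // mulr1 ltW // par_q_gt.
set q : R := (par_q eps)%:R in q1.
have q0 : 1 <= q by rewrite /q ler1n.
rewrite natrM -/q in h1.
set w := weight M in w1 h2 *; set w' := weight out_edges in h3 *.
have h4 : (2 * q - 1) * (2 * w - eps) <= 2 * q * (2 * w').
  apply: (@le_trans _ _ (2 * q * wt2 W mu)).
    by apply: le_trans h1; rewrite ler_wpM2l //; lra.
  by rewrite ler_wpM2l //; lra.
have q2 : 0 < 4 * q by lra.
rewrite -(ler_pM2l q2).
have p1 : 0 <= (eps * q - 1) * w by rewrite mulr_ge0 ?subr_ge0 //; lra.
have p2 : 0 <= eps * q * (w - 1) by rewrite !mulr_ge0 ?subr_ge0 ?(ltW e0) //; lra.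
have := e0.
lra.
Qed.

Lemma out_computed :
  computes_in (mwm_algorithm R k) N eps (par_rounds k n Delta eps (wmin G eps))
    (if (Delta <= 1)%N then edges G else out_edges).
Proof.
move=> v; eexists.
  apply: output_mwm => //; apply: mwm_determined => //; first exact: wmin_gt0.
  exact: wmatrix_wmin.
move=> u; rewrite inE => vu; rewrite /port_output.
case: leqP => _ /=; first by rewrite vu.
have uin : u \in ports N v by rewrite ports_nbrs inE.
rewrite mem_out vu (nth_map u) ?index_mem // nth_index //=.
by rewrite -(idxK idn u) val_eqE.
Qed.

(** For degree at most 1 powers of [Delta] cannot absorb constants, but the full edge set is a
    matching that needs no communication. *)
Lemma edges_matching : (Delta <= 1)%N -> matching (edges G).
Proof.
move=> D1; apply/matchingP; split=> // x y y' xy xy'.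
have /card_le1_eqP := leq_trans (degree_le x) D1.
by apply; rewrite inE.
Qed.

Lemma edges_approx : (Delta <= 1)%N -> approx_mwm eps (edges G).
Proof.
move=> D1; split=> [|M maxM]; first exact: edges_matching.
have w1 := max_weight_ge1 nG maxM; have [/andP[sM _] _] := maxM.
apply: le_trans (weight_sub sM (subxx _)).
by have := mulr_gt0 e0 (lt_le_trans ltr01 w1); lra.
Qed.

End Correctness.

Theorem theorem27 (R : realType) (k : nat) :
  exists (C1 C2 : R) (A : algorithm R) (r : nat -> nat -> R -> R -> nat),
  forall (eps : R), 0 < eps < 1 ->
  forall (G : wgraph R), normalized G ->
  let n := #|G| in
  let Delta := max_degree G in
  let rounds := r n Delta eps (wmin G eps) in
  rounds%:R <= C1 * (eps ^- 2 * lg eps^-1 * (logstar R n)%:R)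
               + Delta%:R `^ (C2 / eps) * lg (wmin G eps)^-1 /\
  forall (N : network G), (forall v : G, (ident N v <= n ^ k)%N) ->
  exists2 M : {set {set G}},
    computes_in A N eps rounds M & approx_mwm eps M.
Proof.
(* The constant [32] comes from the radius [16q] and [q <= 2/eps]; the factor [4] from
   [par_b <= Delta ^ 2] and again [q <= 2/eps]. *)
exists 32, (4 * (49 + 17 * 2 ^ (k + 5)))%:R, (mwm_algorithm R k), (@par_rounds R k).
move=> eps eps01 G nG n Delta rounds; split.
  apply: par_rounds_bound => //; [exact: normalized_card|exact: wmin_gt0].
move=> N idn.
exists (if (Delta <= 1)%N then edges G else @out_edges R k G N eps).
  exact: out_computed.
by case: leqP => D1; [apply: edges_approx|apply: out_approx].
Qed.
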